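(* Let $\beta \in (0,\sqrt{2})$ and let $M$ be the lognormal multiplicative chaos measure $$M(\mathrm{d} x) = \lim_{\varepsilon \to 0} e^{\beta X_\varepsilon(x) - \frac{\beta^2}{2} \mathbb{E} X_\varepsilon(x)^2}\, \mathrm{d} x$$ on $\mathbb{R}$, where $(X_\varepsilon(x))_{x\in\mathbb{R},\,\varepsilon\in(0,1]}$ is the centered Gaussian process with covariance $$\mathbb{E} X_\varepsilon(x) X_{\varepsilon'}(y) = \begin{cases} \log \frac{1}{\varepsilon \vee \varepsilon'} - \left(\frac{1}{\varepsilon \vee \varepsilon'}-1\right) |x-y|, & |x-y| < \varepsilon \vee \varepsilon', \\ \log \frac{1}{|x-y|} - 1 + |x-y|, & \varepsilon \vee \varepsilon' \leq |x-y| \leq 1, \\ 0, & |x-y| > 1. \end{cases}$$ Then the Laplace transform $\phi(t) = \mathbb{E} \exp(-t M([0,1]))$ of the mass of the unit interval satisfies $$\lim_{t \to \infty} \frac{\log \log (1/\phi(t))}{\log \log t} = 2.$$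
   Context: Here $\varepsilon \vee \varepsilon' = \max(\varepsilon,\varepsilon')$. The process $X$ is taken in a version that is continuous in $(x,\varepsilon) \in \mathbb{R}\times(0,1]$. The limit defining $M$ is understood as follows: restricted to any bounded interval, the random measures $e^{\beta X_\varepsilon(x) - \frac{\beta^2}{2} \mathbb{E} X_\varepsilon(x)^2}\, \mathrm{d} x$ converge almost surely, in the sense of weak convergence of measures, as $\varepsilon \to 0$, and $M$ is the limit. It is known that for $\beta<\sqrt{2}$ this limit exists and is almost surely positive on every (nondegenerate) interval. *)

(* Defs.v *)
From HB Require Import structures.
From mathcomp Require Import all_boot all_order all_algebra.
From mathcomp Require Import all_classical all_reals all_analysis.

Set Implicit Arguments.
Unset Strict Implicit.
Unset Printing Implicit Defensive.

Import Order.TTheory GRing.Theory Num.Theory.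
Import numFieldNormedType.Exports.

Local Open Scope classical_set_scope.
Local Open Scope ring_scope.

(* The degenerate law is treated separately because [normal_prob 0 0] is not
   the point mass at 0 but the uniform distribution on [0, 1]. *)
Definition centered_gaussian d (T : measurableType d) (R : realType)
    (P : probability T R) (Y : T -> R) : Prop :=
  exists s : R, forall A : set R, measurable A ->
    P (Y @^-1` A) = if s == 0 then \d_(0 : R) A else normal_prob 0 s A.

Definition centered_gaussian_process d (T : measurableType d) (R : realType)
    (P : probability T R) (I : Type) (D : set I) (X : I -> {RV P >-> R}) : Prop :=
  forall (n : nat) (i : 'I_n -> I) (c : 'I_n -> R), (forall k, D (i k)) ->
    centered_gaussian P (fun w => \sum_(k < n) c k * X (i k) w).

(* The parameters (x, eps) of the process. *)
Definition params (R : realType) : set (R * R) := setT `*` `]0, 1].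

Definition chaos_cov (R : realType) (eps eps' x y : R) : R :=
  let m := Num.max eps eps' in
  let r := `|x - y| in
  if r < m then ln (1 / m) - (1 / m - 1) * r
  else if r <= 1 then ln (1 / r) - 1 + r
  else 0.

(* [X eps x] is X_eps(x); its values for eps outside ]0, 1] are irrelevant. *)
Definition chaos_field d (T : measurableType d) (R : realType)
    (P : probability T R) (X : R -> R -> {RV P >-> R}) : Prop :=
  [/\ centered_gaussian_process (@params R) (fun p => X p.2 p.1),
      (forall eps eps' x y : R, 0 < eps <= 1 -> 0 < eps' <= 1 ->
         'E_P[fun w => (X eps x w * X eps' y w)%R]%E
           = (chaos_cov eps eps' x y)%:E) &
      forall w, {within @params R, continuous (fun p : R * R => X p.2 p.1 w)}].

Definition chaos_density d (T : measurableType d) (R : realType)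
    (P : probability T R) (X : R -> R -> {RV P >-> R}) (beta eps : R)
    (w : T) (x : R) : R :=
  expR (beta * X eps x w
        - beta ^+ 2 / 2 * fine 'E_P[fun w' => (X eps x w' ^+ 2)%R]%E).

(* Weak convergence on D of the measures g_i(x) dx to the finite measure nu,
   tested against the bounded continuous functions on D. *)
Definition density_weak_cvg (R : realType) (D : set R) (I : Type)
    (F : set_system I) (g : I -> R -> R)
    (nu : {measure set (measurableTypeR R) -> \bar R}) : Prop :=
  (nu D < +oo)%E /\
  forall f : R -> R, {within D, continuous f} ->
    (exists C : R, forall x, D x -> `|f x| <= C) ->
    (\int[lebesgue_measure]_(x in D) (f x * g i x)%:E @[i --> F]
       --> \int[nu]_(x in D) (f x)%:E)%E.

(* A random measure is a kernel, so that its masses are random variables. *)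
Definition chaos_measure d (T : measurableType d) (R : realType)
    (P : probability T R) (X : R -> R -> {RV P >-> R}) (beta : R)
    (M : R.-ker T ~> (measurableTypeR R)) : Prop :=
  forall J : interval R, bounded_set [set` J] ->
    {ae P, forall w,
       density_weak_cvg [set` J] 0^'+ (fun eps => chaos_density X beta eps w)
         (M w)}.

(* Stated with [expeR] since a mass may be infinite on a null event. *)
Definition laplace d (T : measurableType d) (R : realType)
    (P : probability T R) (Z : T -> \bar R) (t : R) : R :=
  fine (\int[P]_w expeR (- (t%:E * Z w)))%E.

(* Main.v *)
Require Import Defs.
From HB Require Import structures.
From mathcomp Require Import all_boot all_order all_algebra.
From mathcomp Require Import all_classical all_reals all_analysis.
From mathcomp Require Import measurable_realfun.
From mathcomp Require Import zify ring lra.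

(** Write [M_eps] for the approximating measures and [phi] for the Laplace
    transform; both bounds below are proved for Riemann sums of [M_eps] and pass
    to the limit by dominated convergence.

    Lower bound on [phi].  Tilt by [exp (- r X_(1/2)(1/2))]: since this variable
    is positively correlated with the field on the unit interval, the tilted mean
    of the mass is at most [exp (- c r)], while the second moment of the tilting
    density is [exp (r ^ 2 ln 2)].  Cauchy-Schwarz with [r] proportional to
    [ln t] gives [ln (1 / phi t) = O((ln t) ^ 2)].

    Upper bound on [phi].  With [delta = 1 / (2 N)], the increments
    [X_eps - X_delta] on [N] blocks of length [delta] at mutual distance [delta]
    are uncorrelated copies of the field, and uncorrelated with [X_delta].  The
    mass is small only if all the copies have small masses, an event of
    probability [q ^ N], or if [X_delta] is very negative on average, which is
    controlled by a negative moment of order [r] and Jensen's inequality.  Taking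
    [N] of order [(ln t) ^ 2] and [r] of order [ln t / ln (ln t)] gives
    [ln (1 / phi t) >= c (ln t) ^ 2 / ln (ln t)].

    The bound [q < 1] on the Laplace transform of one block is a truncated second
    moment estimate, valid for [beta ^ 2 < 2].  It is arranged so that
    [exp (- s mass)] is dominated by a linear combination of exponentials of
    Gaussian variables; means of products over the blocks then follow from the
    Gaussian moment generating function alone. *)

Set Implicit Arguments.
Unset Strict Implicit.
Unset Printing Implicit Defensive.

Import Order.TTheory GRing.Theory Num.Theory.
Import numFieldNormedType.Exports.

Local Open Scope classical_set_scope.
Local Open Scope ring_scope.

(** * Means of integrable real random variables *)

Section mean.
Context d (T : measurableType d) (R : realType) (P : probability T R).
Implicit Types (f g : T -> R) (m n c : R).

(** Integrability is bundled with the value, so that linearity needs no side conditions and all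
    computations stay in [R]. *)
Definition is_mean f m : Prop :=
  P.-integrable setT (EFin \o f) /\ (\int[P]_w (f w)%:E = m%:E)%E.

Lemma is_mean_ext f g m : f =1 g -> is_mean f m -> is_mean g m.
Proof. by move=> /funext ->. Qed.

Lemma is_mean_measurable f m : is_mean f m -> measurable_fun setT f.
Proof. by case=> /measurable_int /measurable_EFinP. Qed.

Lemma is_mean_cst c : is_mean (fun=> c) c.
Proof.
split; first exact: finite_measure_integrable_cst.
by rewrite integral_cst// [X in (_ * X)%E]probability_setT mule1.
Qed.

Lemma is_meanD f g m n : is_mean f m -> is_mean g n ->
  is_mean (fun w => f w + g w) (m + n).
Proof.
move=> [intf fm] [intg gn]; split.
  by apply: eq_integrable (integrableD measurableT intf intg).
by under eq_integral do rewrite EFinD; rewrite integralD_EFin//= fm gn.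
Qed.

Lemma is_meanZ f m c : is_mean f m -> is_mean (fun w => c * f w) (c * m).
Proof.
move=> [intf fm]; split.
  by apply: eq_integrable (integrableZl measurableT c intf).
by under eq_integral do rewrite EFinM; rewrite integralZl//= fm.
Qed.

Lemma is_meanB f g m n : is_mean f m -> is_mean g n ->
  is_mean (fun w => f w - g w) (m - n).
Proof.
move=> fm /(@is_meanZ _ _ (-1)) gn; rewrite -mulN1r.
by apply: is_mean_ext (is_meanD fm gn) => w; rewrite mulN1r.
Qed.

Lemma is_mean_sum I (r : seq I) (Q : pred I) (f : I -> T -> R) (m : I -> R) :
  (forall i, Q i -> is_mean (f i) (m i)) ->
  is_mean (fun w => \sum_(i <- r | Q i) f i w) (\sum_(i <- r | Q i) m i).
Proof.
move=> fm; elim: r => [|i r IH].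
  by rewrite big_nil; apply: is_mean_ext (is_mean_cst 0) => w; rewrite big_nil.
rewrite big_cons; case: ifPn => Qi.
  by apply: is_mean_ext (is_meanD (fm i Qi) IH) => w; rewrite big_cons Qi.
by apply: is_mean_ext IH => w; rewrite big_cons (negbTE Qi).
Qed.

Lemma is_mean_le f g m n : (forall w, f w <= g w) ->
  is_mean f m -> is_mean g n -> m <= n.
Proof.
move=> fg [intf fm] [intg gn].
rewrite -lee_fin -fm -gn.
by apply: (le_integral measurableT intf intg) => w _ /=; rewrite lee_fin.
Qed.

Lemma is_mean_dominated f g n : measurable_fun setT f ->
  (forall w, `|f w| <= g w) -> is_mean g n -> exists m, is_mean f m.
Proof.
move=> mf fg [intg gn].
have intf : P.-integrable setT (EFin \o f).
  apply: le_integrable intg => //=; first exact/measurable_EFinP.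
  by move=> w _; rewrite lee_fin (le_trans (fg w))// ler_norm.
exists (fine (\int[P]_w (f w)%:E)); split => //.
by rewrite fineK//; apply: integrable_fin_num.
Qed.

Lemma is_mean_ge0_dominated f g n : measurable_fun setT f ->
  (forall w, 0 <= f w <= g w) -> is_mean g n ->
  exists2 m, is_mean f m & 0 <= m <= n.
Proof.
move=> mf fg gn; have [|m fm] := @is_mean_dominated f g n mf _ gn.
  by move=> w; have /andP[f0] := fg w; rewrite ger0_norm.
exists m => //; apply/andP; split.
  by apply: is_mean_le (is_mean_cst 0) fm => w; case/andP: (fg w).
by apply: is_mean_le fm gn => w; case/andP: (fg w).
Qed.

Lemma is_mean_unique f m n : is_mean f m -> is_mean f n -> m = n.
Proof. by move=> [_ fm] [_]; rewrite fm => -[]. Qed.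

Lemma ge0_is_mean f m : measurable_fun setT f -> (forall w, 0 <= f w) ->
  (\int[P]_w (f w)%:E = m%:E)%E -> is_mean f m.
Proof.
move=> mf f0 fm; split => //; apply/integrableP; split; first exact/measurable_EFinP.
by under eq_integral do rewrite /= ger0_norm//; rewrite fm ltry.
Qed.

End mean.

(** * Exponential moments of the normal law *)

Section normal_moments.
Context (R : realType).
Local Notation mu := (@lebesgue_measure R).

(** The Radon-Nikodym derivative of [normal_prob] and [normal_pdf] have the same integral over every
    measurable set, hence agree almost everywhere. *)
Lemma ge0_integral_normal_prob (m s : R) (f : R -> \bar R) :
  (forall x, (0 <= f x)%E) -> measurable_fun setT f ->
  (\int[normal_prob m s]_x f x = \int[mu]_x (f x * (normal_pdf m s x)%:E))%E.
Proof.
move=> f0 mf; have dom := @normal_prob_dominates R m s.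
rewrite -(Radon_Nikodym_SigmaFinite.change_of_variables dom f0 measurableT mf).
have intD := Radon_Nikodym_SigmaFinite.f_integrable dom.
apply: ae_eq_integral => //.
- by apply: emeasurable_funM => //; exact: measurable_int intD.
- apply: emeasurable_funM => //; apply/measurable_EFinP.
  exact: measurable_normal_pdf.
- apply: ae_eqe_mul2l; apply: integral_ae_eq => //.
    by apply/measurable_EFinP; exact: measurable_normal_pdf.
  by move=> A _ mA; rewrite -(Radon_Nikodym_SigmaFinite.f_integral dom).
Qed.

(** Completing the square turns [expR (u * x)] times the density into a constant times the density
    with mean [u * s ^+ 2]. *)
Lemma normal_prob_mgf (s u : R) : s != 0 ->
  (\int[normal_prob 0 s]_x (expR (u * x))%:E
   = (expR (u ^+ 2 * s ^+ 2 / 2))%:E)%E.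
Proof.
move=> s0; rewrite ge0_integral_normal_prob; last 2 first.
- by move=> x; rewrite lee_fin expR_ge0.
- by apply/measurable_EFinP; apply: measurableT_comp => //; exact: mulrl_measurable.
have pdfE x : ((expR (u * x))%:E * (normal_pdf 0 s x)%:E
    = (expR (u ^+ 2 * s ^+ 2 / 2))%:E * (normal_pdf (u * s ^+ 2) s x)%:E)%E.
  rewrite !normal_pdfE//= -!EFinM /normal_fun; congr (_%:E).
  rewrite mulrCA [in RHS]mulrCA -!expRD; congr (_ * expR _).
  by field.
under eq_integral do rewrite pdfE.
rewrite integralZl//; last exact: integrable_normal_pdf.
by rewrite integral_normal_pdf mule1.
Qed.

End normal_moments.

(** * Elementary inequalities for the exponential *)

Lemma expRDN_bounds (R : realType) (z : R) :
  z ^+ 2 * expR (- `|z|) <= expR z + expR (- z) - 2 <= z ^+ 2 * expR `|z|.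
Proof.
wlog z0 : z / 0 <= z.
  move=> H; have [/H//|z0] := lerP 0 z.
  have := H (- z); rewrite sqrrN normrN opprK [expR (- z) + _]addrC; apply.
  by rewrite oppr_ge0 ltW.
rewrite ger0_norm//; set a := expR (z / 2); set b := expR (- z / 2).
have aE : expR z = a ^+ 2 by rewrite /a -expRM_natr; congr expR; field.
have bE : expR (- z) = b ^+ 2 by rewrite /b -expRM_natr; congr expR; field.
have ab1 : a * b = 1 by rewrite /a /b -expRD mulNr subrr expR0.
have a0 : 0 < a by exact: expR_gt0.
have b0 : 0 < b by exact: expR_gt0.
(* The middle quantity is [(a - b) ^+ 2]; applying [1 + x <= expR x] at [z] and at [- z] places
   [a - b] between [z * b] and [z * a]. *)
have h1 : b * (1 + z) <= a.
  have -> : a = b * expR z by rewrite aE expr2 mulrA [b * a]mulrC ab1 mul1r.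
  by rewrite ler_pM2l// expR_ge1Dx.
have h2 : a * (1 - z) <= b.
  have -> : b = a * expR (- z) by rewrite bE expr2 mulrA ab1 mul1r.
  by rewrite ler_pM2l// expR_ge1Dx.
have -> : expR z + expR (- z) - 2 = (a - b) ^+ 2.
  by rewrite aE bE sqrrB ab1; ring.
have zb : z * b <= a - b by rewrite lerBrDr; move: h1; rewrite mulrDr mulr1 addrC mulrC.
have za : a - b <= z * a by move: h2; rewrite mulrBr mulr1 [a * z]mulrC; lra.
have zb0 : 0 <= z * b by rewrite mulr_ge0// ltW.
by rewrite aE bE -!exprMn !lerXn2r// ?nnegrE// ?(le_trans zb0)// (le_trans zb).
Qed.

Lemma ler_cube_expR (R : realType) (y : R) : 0 <= y -> y ^+ 3 <= 27 * expR y.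
Proof.
move=> y0; have h : y / 3 <= expR (y / 3).
  by apply: le_trans (expR_ge1Dx _); rewrite lerDr.
have -> : y ^+ 3 = 27 * (y / 3) ^+ 3 by field.
have -> : expR y = expR (y / 3) ^+ 3 by rewrite -expRM_natr; congr expR; field.
by rewrite ler_pM2l// lerXn2r// nnegrE ?expR_ge0// divr_ge0.
Qed.

Lemma ler_sqr_expR (R : realType) (y : R) : y ^+ 2 <= 4 * (expR y + expR (- y)).
Proof.
wlog y0 : y / 0 <= y.
  move=> H; have [/H//|y0] := lerP 0 y.
  have := H (- y); rewrite sqrrN opprK [expR (- y) + _]addrC; apply.
  by rewrite oppr_ge0 ltW.
have h : y / 2 <= expR (y / 2).
  by apply: le_trans (expR_ge1Dx _); rewrite lerDr.
have -> : y ^+ 2 = 4 * (y / 2) ^+ 2 by field.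
rewrite ler_pM2l//; apply: (@le_trans _ _ (expR y)); last by rewrite lerDl expR_ge0.
have -> : expR y = expR (y / 2) ^+ 2 by rewrite -expRM_natr; congr expR; field.
by rewrite lerXn2r// nnegrE ?expR_ge0// divr_ge0.
Qed.

Lemma expR_norm_le (R : realType) (y : R) : expR `|y| <= expR y + expR (- y).
Proof.
by case: (ger0P y) => _; rewrite ?lerDl ?lerDr expR_ge0.
Qed.

Lemma eq_of_norm_le_linear (R : realType) (a b C : R) :
  (forall u : R, 0 < u <= 1 -> `|a - b| <= u * C) -> a = b.
Proof.
move=> H; apply/eqP; rewrite -subr_eq0 -normr_le0 leNgt; apply/negP => ab0.
have C0 : 0 < C by apply: lt_le_trans ab0 _; have := H 1; rewrite mul1r ltr01 lexx; exact.
have := H (Num.min 1 (`|a - b| / (2 * C))).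
rewrite lt_min ltr01 ge_min lexx/= divr_gt0//; last by rewrite mulr_gt0.
move=> /(_ isT); apply/negP; rewrite -ltNge.
apply: (@le_lt_trans _ _ (`|a - b| / (2 * C) * C)).
  by rewrite ler_pM2r// ge_min lexx orbT.
by rewrite invfM -!mulrA mulVf ?gt_eqF// mulr1; lra.
Qed.

(** * Moment generating function and variance of a centered Gaussian variable *)

Section gaussian_moments.
Context d (T : measurableType d) (R : realType) (P : probability T R).
Variables (Y : T -> R) (s : R).
Hypotheses (mY : measurable_fun setT Y)
  (lawY : forall A : set R, measurable A ->
    P (Y @^-1` A) = if s == 0 then \d_(0 : R) A else normal_prob 0 s A).

Lemma gaussian_mgf (u : R) : is_mean P (fun w => expR (u * Y w)) (expR (u ^+ 2 * s ^+ 2 / 2)).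
Proof.
apply: ge0_is_mean => [|w|]; last 2 first.
- exact: expR_ge0.
- pose Y' : T -> measurableTypeR R := Y.
  have mY' : measurable_fun setT Y' by exact: mY.
  pose h (x : measurableTypeR R) : \bar R := (expR (u * x))%:E.
  have mh : measurable_fun setT h.
    by apply/measurable_EFinP; apply: measurableT_comp => //; exact: mulrl_measurable.
  have h0 : {in setT, forall y, (0 <= h y)%E}.
    by move=> x _; rewrite lee_fin expR_ge0.
  transitivity (\int[pushforward P Y']_y h y)%E.
    by rewrite (@ge0_integral_pushforward _ _ _ _ _ Y' mY' P setT h).
  have [s0|s0] := eqVneq s 0.
    rewrite (@eq_measure_integral _ _ _ _ (\d_(0 : measurableTypeR R)))//; last first.
      by move=> A mA _; rewrite /= /pushforward lawY// s0 eqxx.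
    by rewrite integral_dirac// diracT mul1e /h s0 mulr0 expr0n/= mulr0 mul0r.
  rewrite -(normal_prob_mgf u s0); apply: eq_measure_integral => A mA _.
  by rewrite /= /pushforward lawY// (negbTE s0).
- by apply: measurableT_comp => //; apply: measurable_funM.
Qed.

(* [(exp (u Y) + exp (- u Y) - 2) / u ^ 2] has a known mean and differs from
   [Y ^ 2] by [O(u)] in mean. *)
Lemma gaussian_variance : is_mean P (fun w => Y w ^+ 2) (s ^+ 2).
Proof.
have [|m Ym _] := @is_mean_ge0_dominated _ _ _ P (fun w => Y w ^+ 2)
    (fun w => 4 * (expR (1 * Y w) + expR (-1 * Y w))) _ (measurable_funX 2 mY) _
    (is_meanZ 4 (is_meanD (gaussian_mgf 1) (gaussian_mgf (-1)))).
  by move=> w; rewrite sqr_ge0/= mul1r mulN1r ler_sqr_expR.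
suff <- : m = s ^+ 2 by [].
pose C1 : R := 54 * (expR (2 ^+ 2 * s ^+ 2 / 2) + expR ((-2) ^+ 2 * s ^+ 2 / 2)).
pose x := s ^+ 2 / 2.
apply: (@eq_of_norm_le_linear _ _ _ (C1 + 2 * x ^+ 2 * expR x)) => u /andP[u0 u1].
have u20 : 0 < u ^+ 2 by rewrite exprn_gt0.
pose mu := 2 * (expR (u ^+ 2 * x) - 1) / u ^+ 2.
have fm : is_mean P
    (fun w => (u ^+ 2)^-1 * (expR (u * Y w) + expR (- u * Y w) - 2)) mu.
  have := is_meanZ (u ^+ 2)^-1 (is_meanB (is_meanD (gaussian_mgf u) (gaussian_mgf (- u)))
    (is_mean_cst P 2)).
  set m' := (X in is_mean _ _ X); suff -> : m' = mu by [].
  by rewrite /m' /mu /x sqrrN mulrA; field; rewrite gt_eqF.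
have x0 : 0 <= x by rewrite /x divr_ge0// sqr_ge0.
have mus : `|mu - s ^+ 2| <= u * (2 * x ^+ 2 * expR x).
  have -> : mu - s ^+ 2 = 2 / u ^+ 2 * (expR (u ^+ 2 * x) - 1 - u ^+ 2 * x).
    by rewrite /mu /x; field; rewrite gt_eqF.
  set y := u ^+ 2 * x; have y0 : 0 <= y by rewrite mulr_ge0// ltW.
  have yx : y <= x by rewrite ler_piMl// expr_le1// ltW.
  have h1 : 1 + y <= expR y := expR_ge1Dx y.
  have h2 : expR y - 1 <= y * expR y.
    have : expR y * (1 - y) <= 1.
      rewrite -[leRHS](expRxMexpNx_1 y) ler_pM2l ?expR_gt0//; exact: expR_ge1Dx.
    by lra.
  have h3 : expR y - 1 - y <= y * (x * expR x) * u.
    apply: (@le_trans _ _ (y * (expR y - 1))); first by rewrite mulrBr mulr1 lerB.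
    rewrite -mulrA ler_wpM2l//; apply: (le_trans h2); rewrite mulrC.
    apply: (@le_trans _ _ (expR x * y)); first by rewrite ler_wpM2r// ler_expR.
    rewrite [x * _]mulrC -mulrA ler_wpM2l ?expR_ge0//.
    by rewrite /y mulrC ler_wpM2l// expr2 ler_piMl// ltW.
  rewrite ger0_norm; last first.
    by apply: mulr_ge0; [rewrite divr_ge0// ltW|lra].
  apply: (@le_trans _ _ (2 / u ^+ 2 * (y * (x * expR x) * u))).
    by rewrite ler_pM2l// divr_gt0.
  by rewrite /y le_eqVlt; apply/orP; left; apply/eqP; field; rewrite gt_eqF.
have mm : `|m - mu| <= u * C1.
  (* With [z = u * |v|] the error is at most [v ^+ 2 * (z * expR z)], which is [u] times a cube
     times an exponential; the cube is then absorbed into another exponential. *)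
  have key w : `|Y w ^+ 2 - (u ^+ 2)^-1 * (expR (u * Y w) + expR (- u * Y w) - 2)|
      <= (54 * u) * (expR (2 * Y w) + expR (- 2 * Y w)).
    set v := Y w; have /andP[] := expRDN_bounds (u * v).
    rewrite [- u * v]mulNr; set c := _ - 2 => lo hi.
    have vv : (u ^+ 2)^-1 * (u * v) ^+ 2 = v ^+ 2 by rewrite exprMn mulKf// gt_eqF.
    have {}lo : v ^+ 2 * expR (- `|u * v|) <= (u ^+ 2)^-1 * c.
      by rewrite -vv -mulrA ler_wpM2l// invr_ge0 ltW.
    have {}hi : (u ^+ 2)^-1 * c <= v ^+ 2 * expR `|u * v|.
      by rewrite -vv -mulrA ler_wpM2l// invr_ge0 ltW.
    set z := `|u * v| in lo hi *; have z0 : 0 <= z by exact: normr_ge0.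
    have zE : z = u * `|v| by rewrite /z normrM gtr0_norm.
    have g1 : 1 - z <= expR (- z) by exact: expR_ge1Dx.
    have g2 : expR z - 1 <= z * expR z.
      have : expR z * (1 - z) <= 1.
        rewrite -[leRHS](expRxMexpNx_1 z) ler_pM2l ?expR_gt0//; exact: expR_ge1Dx.
      by lra.
    have g3 : z <= z * expR z by rewrite ler_peMr// (le_trans _ (expR_ge1Dx _))// lerDl.
    have v20 : 0 <= v ^+ 2 by exact: sqr_ge0.
    apply: (@le_trans _ _ (v ^+ 2 * (z * expR z))).
      rewrite ler_norml; apply/andP; split.
        have : v ^+ 2 * (expR z - 1) <= v ^+ 2 * (z * expR z) by rewrite ler_wpM2l.
        by lra.
      have : v ^+ 2 * (1 - expR (- z)) <= v ^+ 2 * (z * expR z).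
        by rewrite ler_wpM2l//; lra.
      by lra.
    have -> : v ^+ 2 * (z * expR z) = u * (`|v| ^+ 3 * expR z).
      by rewrite zE -(real_normK (num_real v)); ring.
    have zv : expR z <= expR `|v|.
      by rewrite ler_expR zE ler_piMl// ltW.
    have v3 : `|v| ^+ 3 <= 27 * expR `|v| by apply: ler_cube_expR.
    have e2 : expR `|v| * expR `|v| <= expR (2 * v) + expR (- 2 * v).
      have -> : expR `|v| * expR `|v| = expR `|2 * v|.
        by rewrite -expRD normrM ger0_norm//; congr expR; ring.
      by rewrite mulNr expR_norm_le.
    rewrite (mulrC 54 u) -(mulrA u) ler_pM2l//.
    apply: (@le_trans _ _ (27 * expR `|v| * expR `|v|)).
      by apply: ler_pM => //; rewrite ?exprn_ge0 ?expR_ge0.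
    rewrite -mulrA; apply: (@le_trans _ _ (27 * (expR (2 * v) + expR (- 2 * v)))).
      by rewrite ler_pM2l.
    have : 0 <= expR (2 * v) + expR (- 2 * v) by rewrite addr_ge0 ?expR_ge0.
    by lra.
  have gm := is_meanZ (54 * u) (is_meanD (gaussian_mgf 2) (gaussian_mgf (- 2))).
  have -> : u * C1 = 54 * u * (expR (2 ^+ 2 * s ^+ 2 / 2) + expR ((-2) ^+ 2 * s ^+ 2 / 2)).
    by rewrite /C1; ring.
  have dm := is_meanB Ym fm; rewrite ler_norml; apply/andP; split.
    have := @is_mean_le _ _ _ _ _ _ _ _ _ (is_meanZ (-1) gm) dm.
    by rewrite mulN1r; apply => w; have := key w; rewrite ler_norml mulN1r => /andP[].
  apply: (is_mean_le _ dm gm) => w.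
  by have := key w; rewrite ler_norml => /andP[].
rewrite mulrDr; apply: le_trans (lerD mm mus).
have -> : m - s ^+ 2 = (m - mu) + (mu - s ^+ 2) by ring.
exact: ler_normD.
Qed.

End gaussian_moments.

(** * Formal linear combinations and their covariances *)

Section linear_forms.
Context (R : realType) (I : Type).
Implicit Types (L : seq (R * I)) (z : I -> R) (K : I -> I -> R).

(** A list of pairs (coefficient, index) is a formal linear combination; indices may repeat, so
    concatenation is addition. *)
Definition linform z L : R := \sum_(p <- L) p.1 * z p.2.

Definition covform K L L' : R :=
  \sum_(p <- L) \sum_(q <- L') p.1 * q.1 * K p.2 q.2.

Lemma linform_cat z L L' : linform z (L ++ L') = linform z L + linform z L'.
Proof. by rewrite /linform big_cat. Qed.

Lemma covform_catl K L L' L'' :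
  covform K (L ++ L') L'' = covform K L L'' + covform K L' L''.
Proof. by rewrite /covform big_cat. Qed.

Lemma covform_catr K L L' L'' :
  covform K L (L' ++ L'') = covform K L L' + covform K L L''.
Proof.
by rewrite /covform -big_split/=; apply: eq_bigr => p _; rewrite big_cat.
Qed.

Lemma covform0 K L L' (Q Q' : pred I) :
  all (fun p => Q p.2) L -> all (fun p => Q' p.2) L' ->
  (forall i j, Q i -> Q' j -> K i j = 0) -> covform K L L' = 0.
Proof.
move=> QL QL' K0; rewrite /covform.
elim: L QL => [|p L IH] /=; first by rewrite big_nil.
case/andP=> Qp /IH; rewrite big_cons => ->; rewrite addr0; clear IH.
elim: L' QL' => [|q L' IH'] /=; first by rewrite big_nil.
by case/andP=> Qq /IH'; rewrite big_cons => ->; rewrite addr0 K0// mulr0.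
Qed.

End linear_forms.

Lemma linform_map (R : realType) (I J : Type) (f : I -> J) (z : J -> R)
    (L : seq (R * I)) :
  linform z [seq (p.1, f p.2) | p <- L] = linform (z \o f) L.
Proof. by rewrite /linform big_map. Qed.

Lemma covform_map (R : realType) (I J : Type) (f : I -> J) (K : J -> J -> R)
    (L L' : seq (R * I)) :
  covform K [seq (p.1, f p.2) | p <- L] [seq (p.1, f p.2) | p <- L']
  = covform (fun i j => K (f i) (f j)) L L'.
Proof. by rewrite /covform big_map; apply: eq_bigr => p _; rewrite big_map. Qed.

Section bind.
Context (R : realType) (I J : Type) (F : J -> seq (R * I)).

(** Substitution of the combination [F j] for each formal variable [j]. *)
Definition linbind (L : seq (R * J)) : seq (R * I) :=
  flatten [seq [seq (p.1 * q.1, q.2) | q <- F p.2] | p <- L].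

Lemma linform_bind z L : linform z (linbind L) = linform (fun j => linform z (F j)) L.
Proof.
elim: L => [|p L IH]; first by rewrite /linform !big_nil.
rewrite /linbind/= linform_cat IH [RHS]/linform big_cons; congr (_ + _).
by rewrite /linform big_map big_distrr; apply: eq_bigr => q _ /=; rewrite mulrA.
Qed.

Lemma covform_bind K L L' : covform K (linbind L) (linbind L')
  = covform (fun j j' => covform K (F j) (F j')) L L'.
Proof.
elim: L => [|p L IH]; first by rewrite /covform !big_nil.
rewrite /linbind/= covform_catl IH [RHS]/covform big_cons; congr (_ + _).
clear IH; elim: L' => [|p' L' IH].
  by rewrite /linbind/= /covform big_nil big1// => q _; rewrite big_nil.
rewrite /linbind/= covform_catr IH big_cons; congr (_ + _).
rewrite /covform big_map big_distrr; apply: eq_bigr => q _.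
by rewrite big_map big_distrr; apply: eq_bigr => q' _ /=; ring.
Qed.

End bind.

(** * Gaussian families *)

Section gaussian_family.
Context d (T : measurableType d) (R : realType) (P : probability T R).

(** Joint Gaussianity and the covariance are encoded by the moment generating function alone, the
    only feature used by the later estimates. *)
Definition gaussian_family (I : Type) (Y : I -> T -> R) (K : I -> I -> R) : Prop :=
  (forall i, measurable_fun setT (Y i)) /\
  forall L, is_mean P (fun w => expR (linform (Y^~ w) L)) (expR (covform K L L / 2)).

Lemma gaussian_family_bind (I J : Type) (F : J -> seq (R * I))
    (Y : I -> T -> R) (K : I -> I -> R) (K' : J -> J -> R) :
  gaussian_family Y K -> (forall j j', covform K (F j) (F j') = K' j j') ->
  gaussian_family (fun j w => linform (Y^~ w) (F j)) K'.
Proof.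
move=> [mY YK] FK'; split=> [j|L].
  by apply: measurable_sum => p; apply: measurable_funM.
have := YK (linbind F L); rewrite covform_bind.
have -> : (fun j j' => covform K (F j) (F j')) = K'.
  by apply/funext => j; apply/funext => j'.
by apply: is_mean_ext => w; rewrite linform_bind.
Qed.

End gaussian_family.

(** * The field as a Gaussian family *)

Section chaos_family.
Context d (T : measurableType d) (R : realType) (P : probability T R).
Variables (X : R -> R -> {RV P >-> R}) (hX : chaos_field X).

Let X_gaussian (J : Type) (e x : J -> R) (L : seq (R * J)) :
  (forall j, 0 < e j <= 1) ->
  exists s : R, is_mean P (fun w => expR (linform (fun j => X (e j) (x j) w) L)) (expR (s / 2))
    /\ is_mean P (fun w => linform (fun j => X (e j) (x j) w) L ^+ 2) s.
Proof.
move=> e01; case: hX => gX _ _.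
pose t := in_tuple L.
have [|s lawY] := gX (size L) (fun k => (x (tnth t k).2, e (tnth t k).2)) (fun k => (tnth t k).1).
  by move=> k; split => //=; rewrite in_itv/= e01.
have YE w : \sum_(k < size L) (tnth t k).1 * X (e (tnth t k).2) (x (tnth t k).2) w
    = linform (fun j => X (e j) (x j) w) L.
  by rewrite /linform (big_tnth _ _ L).
have YE' : (fun w => \sum_(k < size L) (tnth t k).1 * X (e (tnth t k).2) (x (tnth t k).2) w)
    = (fun w => linform (fun j => X (e j) (x j) w) L) by apply/funext.
rewrite /= YE' in lawY.
have mY : measurable_fun setT (fun w => linform (fun j => X (e j) (x j) w) L).
  by apply: measurable_sum => p; apply: measurable_funM.
exists (s ^+ 2); split; last exact: gaussian_variance mY lawY.
have := gaussian_mgf mY lawY 1; rewrite expr1n mul1r.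
by apply: is_mean_ext => w; rewrite mul1r.
Qed.

(** [chaos_field] provides the value of the expectation; integrability of the product follows from
    that of the squares, since [|a * b| <= a ^+ 2 + b ^+ 2]. *)
Lemma chaos_covE (e e' x y : R) : 0 < e <= 1 -> 0 < e' <= 1 ->
  is_mean P (fun w => X e x w * X e' y w) (chaos_cov e e' x y).
Proof.
move=> e01 e'01.
have sq (a u : R) : 0 < a <= 1 -> exists s, is_mean P (fun w => X a u w ^+ 2) s.
  move=> a01; have [//|s [_ Hs]] := @X_gaussian unit (fun=> a) (fun=> u) [:: (1, tt)].
  by exists s; apply: is_mean_ext Hs => w; rewrite /linform big_seq1 mul1r.
have [s Hs] := sq e x e01; have [s' Hs'] := sq e' y e'01.
have mXX : measurable_fun setT (fun w => X e x w * X e' y w) by exact: measurable_funM.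
have [|m Hm] := @is_mean_dominated _ _ _ P _ _ _ mXX _ (is_meanD Hs Hs').
  move=> w; rewrite ler_norml; set a := X e x w; set b := X e' y w.
  have := sqr_ge0 (a + b); have := sqr_ge0 (a - b); rewrite sqrrB sqrrD.
  have := sqr_ge0 a; have := sqr_ge0 b; move: (a ^+ 2) (b ^+ 2) => A B.
  by move=> ? ? ? ?; apply/andP; split; lra.
suff -> : chaos_cov e e' x y = m by [].
case: hX => _ /(_ e e' x y e01 e'01) + _.
by rewrite unlock; case: Hm => _ -> [].
Qed.

(** The variance provided by joint Gaussianity is identified by expanding the square of the linear
    form and taking means term by term. *)
Lemma chaos_gaussian_family (J : Type) (e x : J -> R) :
  (forall j, 0 < e j <= 1) ->
  gaussian_family P (fun j => X (e j) (x j) : T -> R)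
    (fun j j' => chaos_cov (e j) (e j') (x j) (x j')).
Proof.
move=> e01; split=> [j|L]; first exact: measurable_funPT.
have [s [Hs Hs2]] := X_gaussian x L e01.
suff <- : s = covform (fun j j' => chaos_cov (e j) (e j') (x j) (x j')) L L by [].
apply: (is_mean_unique Hs2); rewrite /covform.
have := @is_mean_sum _ _ _ P _ L xpredT _ _ (fun p _ =>
  @is_mean_sum _ _ _ P _ L xpredT _ _ (fun q _ =>
   is_meanZ (p.1 * q.1) (chaos_covE (x p.2) (x q.2) (e01 p.2) (e01 q.2)))).
apply: is_mean_ext => w; rewrite expr2 {1}/linform big_distrl; apply: eq_bigr => p _.
by rewrite /linform big_distrr; apply: eq_bigr => q _ /=; ring.
Qed.

End chaos_family.

(** * Linear combinations of exponentials of linear forms *)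

Section exponential_polynomials.
Context (R : realType) (I : Type) (K : I -> I -> R).

(* [h] is a combination of exponentials of linear forms in [z], and [m] is its
   mean when [z] is a centered Gaussian family with covariance [K]. *)
Definition exp_poly (h : (I -> R) -> R) (m : R) : Prop :=
  exists s : seq (R * seq (R * I)),
    h = (fun z => \sum_(a <- s) a.1 * expR (linform z a.2)) /\
    m = \sum_(a <- s) a.1 * expR (covform K a.2 a.2 / 2).

Lemma exp_poly_expR c L :
  exp_poly (fun z => expR (linform z L + c)) (expR (covform K L L / 2 + c)).
Proof.
exists [:: (expR c, L)]; split; last by rewrite big_seq1 /= expRD mulrC.
by apply/funext => z; rewrite big_seq1/= expRD mulrC.
Qed.

Lemma exp_polyD h m h' m' : exp_poly h m -> exp_poly h' m' ->
  exp_poly (fun z => h z + h' z) (m + m').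
Proof.
move=> [s [-> ->]] [s' [-> ->]]; exists (s ++ s').
by split; rewrite ?big_cat//; apply/funext => z; rewrite big_cat.
Qed.

Lemma exp_polyZ c h m : exp_poly h m -> exp_poly (fun z => c * h z) (c * m).
Proof.
move=> [s [-> ->]]; exists [seq (c * a.1, a.2) | a <- s]; split.
  apply/funext => z; rewrite big_map big_distrr/=.
  by apply: eq_bigr => a _; rewrite mulrA.
by rewrite big_map big_distrr/=; apply: eq_bigr => a _; rewrite mulrA.
Qed.

Lemma exp_poly_cst c : exp_poly (fun=> c) c.
Proof.
exists [:: (c, [::])]; split; first apply/funext => z;
  by rewrite big_seq1 ?/covform /linform !big_nil ?mul0r expR0 mulr1.
Qed.

Lemma exp_polyB h m h' m' : exp_poly h m -> exp_poly h' m' ->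
  exp_poly (fun z => h z - h' z) (m - m').
Proof.
move=> Hh /(exp_polyZ (-1)) /(exp_polyD Hh); rewrite mulN1r.
by congr exp_poly; apply/funext => z; rewrite mulN1r.
Qed.

Lemma exp_poly_sum (J : Type) (r : seq J) (Q : pred J) (h : J -> (I -> R) -> R) (m : J -> R) :
  (forall j, Q j -> exp_poly (h j) (m j)) ->
  exp_poly (fun z => \sum_(j <- r | Q j) h j z) (\sum_(j <- r | Q j) m j).
Proof.
move=> Hh; elim: r => [|j r IH].
  by rewrite big_nil; under eq_fun do rewrite big_nil; exact: exp_poly_cst.
rewrite big_cons; under eq_fun do rewrite big_cons.
by case: ifPn => // Qj; apply: exp_polyD => //; exact: Hh.
Qed.

End exponential_polynomials.

(* Expanding the product leaves exponentials of linear forms whose variances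
   add up over uncorrelated blocks. *)
Lemma is_mean_prod_exp_poly d (T : measurableType d) (R : realType)
    (P : probability T R) (I : Type) (K : I -> I -> R) (h : (I -> R) -> R) (m : R)
    (Y : nat * I -> T -> R) (N : nat) :
  exp_poly K h m ->
  gaussian_family P Y (fun p q => if p.1 == q.1 then K p.2 q.2 else 0) ->
  is_mean P (fun w => \prod_(j < N) h (fun i => Y (val j, i) w)) (m ^+ N).
Proof.
move=> [s [-> ->]] [mY YK]; set K' := (fun p q => _) in YK.
set m' := \sum_(a <- s) _.
(* The extra linear form [L0], supported on blocks of index at least [N], collects the terms already
   chosen from the expanded factors, so that an induction on [N] applies. *)
suff gen L0 : all (fun p => N <= p.2.1)%N L0 ->
    is_mean P (fun w => expR (linform (Y^~ w) L0) *
      \prod_(j < N) \sum_(a <- s) a.1 * expR (linform (fun i => Y (val j, i) w) a.2))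
      (expR (covform K' L0 L0 / 2) * m' ^+ N).
  have := gen [::] isT; rewrite {1}/covform big_nil mul0r expR0 mul1r.
  by apply: is_mean_ext => w; rewrite /linform big_nil expR0 mul1r.
elim: N L0 => [|N IH] L0 NL0.
  by rewrite expr0 mulr1; apply: is_mean_ext (YK L0) => w; rewrite big_ord0 mulr1.
pose E (L : seq (R * I)) := [seq (p.1, (N, p.2)) | p <- L].
have EN L : all (fun p => p.2.1 == N) (E L) by rewrite /E; elim: L => //= p L ->; rewrite eqxx.
have allE L : all (fun p => N <= p.2.1)%N (L0 ++ E L).
  rewrite all_cat (sub_all _ NL0)/=; last by move=> p /ltnW.
  by apply: sub_all (EN L) => p /eqP ->.
have covE L : covform K' (L0 ++ E L) (L0 ++ E L) = covform K' L0 L0 + covform K L L.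
  rewrite covform_catl !covform_catr.
  have c1 : covform K' L0 (E L) = 0.
    apply: (@covform0 _ _ _ _ _ (fun i => N < i.1)%N (fun i => i.1 == N)) => //.
    by move=> i j Ni /eqP jN; rewrite /K' jN eq_sym ltn_eqF.
  have c2 : covform K' (E L) L0 = 0.
    apply: (@covform0 _ _ _ _ _ (fun i => i.1 == N) (fun i => N < i.1)%N) => //.
    by move=> i j /eqP iN Nj; rewrite /K' iN ltn_eqF.
  rewrite c1 c2 addr0 add0r; congr (_ + _).
  rewrite /E covform_map; congr (covform _ _ _).
  by apply/funext => i; apply/funext => j; rewrite /K' /= eqxx.
have step (a : R * seq (R * I)) := is_meanZ a.1 (IH (L0 ++ E a.2) (allE a.2)).
have := @is_mean_sum _ _ _ P _ s xpredT _ _ (fun a _ => step a).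
have -> : \sum_(a <- s) a.1 *
    (expR (covform K' (L0 ++ E a.2) (L0 ++ E a.2) / 2) * m' ^+ N)
    = expR (covform K' L0 L0 / 2) * m' ^+ N.+1.
  set M := m' ^+ N; rewrite exprS -/M mulrCA /m' big_distrl/=.
  apply: eq_bigr => a _.
  by rewrite covE mulrDl expRD; ring.
apply: is_mean_ext => w; rewrite big_ord_recr/= [RHS]mulrA big_distrr/=.
apply: eq_bigr => a _; rewrite linform_cat expRD /E linform_map.
by rewrite /comp/=; ring.
Qed.

(** * The covariance at dyadic scales, and dyadic counting *)

Section chaos_cov_facts.
Context (R : realType).
Implicit Types (e x y : R) (k n : nat).

Lemma chaos_covC e e' x y : chaos_cov e e' x y = chaos_cov e' e y x.
Proof. by rewrite /chaos_cov maxC distrC. Qed.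

Lemma chaos_cov_diag e e' x : 0 < e -> chaos_cov e e' x x = - ln (Num.max e e').
Proof.
move=> e0; have m0 : 0 < Num.max e e' by rewrite lt_max e0.
by rewrite /chaos_cov subrr normr0 m0 mulr0 subr0 div1r lnV.
Qed.

Lemma ln_exp2V k : ln (2 ^- k : R) = - (k%:R * ln 2).
Proof. by rewrite lnV ?posrE ?exprn_gt0// lnXn// mulr_natl. Qed.

Lemma exp2V_gt0 k : 0 < (2 ^- k : R).
Proof. by rewrite invr_gt0 exprn_gt0. Qed.

Lemma exp2V_le1 k : (2 ^- k : R) <= 1.
Proof. by rewrite invf_le1 ?exprn_gt0// exprn_ege1// ler1n. Qed.

Lemma ler_exp2V k n : (k <= n)%N -> (2 ^- n : R) <= 2 ^- k.
Proof. by move=> kn; rewrite lef_pV2 ?posrE ?exprn_gt0// ler_weXn2l// ler1n. Qed.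

Lemma ln2_gt0 : 0 < ln (2 : R).
Proof. by rewrite ln_gt0// ltr1n. Qed.

Lemma chaos_cov_dyadic_diag k n x : (k <= n)%N ->
  chaos_cov (2 ^- k) (2 ^- n) x x = k%:R * ln 2.
Proof.
move=> kn; rewrite chaos_cov_diag ?exp2V_gt0// max_l ?ler_exp2V//.
by rewrite ln_exp2V opprK.
Qed.

(** Up to distance [2 ^- k] the linear correction to the logarithm costs at most 1. *)
Lemma chaos_cov_dyadic_ge k n x y : (k <= n)%N -> `|x - y| <= 2 ^- k ->
  k%:R * ln 2 - 1 <= chaos_cov (2 ^- k) (2 ^- n) x y.
Proof.
move=> kn xy; rewrite /chaos_cov max_l ?ler_exp2V//.
have e0 := exp2V_gt0 k; set e : R := 2 ^- k in xy e0 *.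
have lnE : ln (1 / e) = k%:R * ln 2 by rewrite div1r lnV ?posrE// ln_exp2V opprK.
case: ltP => [r|r].
  rewrite lnE lerD2l lerN2.
  have re : 1 / e * `|x - y| <= 1 by rewrite div1r mulrC ler_pdivrMr// mul1r.
  have := normr_ge0 (x - y); rewrite mulrBl; lra.
have -> : `|x - y| = e by apply/eqP; rewrite eq_le xy r.
by rewrite exp2V_le1 lnE; lra.
Qed.

(** Points separated by more than [2 ^- k.+1] share only the scales up to [k.+1]; for [k = n] the
    variance itself is a bound. *)
Lemma chaos_cov_dyadic_le k n x y : (k <= n)%N ->
  (k = n \/ 2 ^- k.+1 < `|x - y|) ->
  chaos_cov (2 ^- n) (2 ^- n) x y <= k.+1%:R * ln 2.
Proof.
move=> kn near; rewrite /chaos_cov maxxx.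
have l2 := ltW ln2_gt0.
have e0 := exp2V_gt0 n; set e : R := 2 ^- n in e0 *.
have lnE : ln (1 / e) = n%:R * ln 2 by rewrite div1r lnV ?posrE// ln_exp2V opprK.
case: ltP => [r|r].
  have nk : (n <= k.+1)%N.
    case: near => [->//|h]; rewrite leqNgt; apply/negP => nk.
    have := ler_exp2V (ltnW nk); rewrite -/e => ek.
    by have := lt_trans h r; rewrite ltNge ek.
  apply: (@le_trans _ _ (n%:R * ln 2)); last by rewrite ler_wpM2r// ler_nat.
  rewrite lnE gerBl mulr_ge0// subr_ge0 div1r invf_ge1//; exact: exp2V_le1.
case: ifPn => [r1|_]; last by rewrite mulr_ge0.
have r0 : 0 < `|x - y| by exact: lt_le_trans r.
have : ln (1 / `|x - y|) <= k.+1%:R * ln 2.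
  rewrite div1r lnV ?posrE//.
  have -> : k.+1%:R * ln 2 = - ln (2 ^- k.+1 : R) by rewrite ln_exp2V opprK.
  rewrite lerN2 ler_ln ?posrE// ?exp2V_gt0//; case: near => [kE|/ltW//].
  by apply: le_trans r; rewrite kE ler_exp2V.
lra.
Qed.

End chaos_cov_facts.

(** Multiply by [1 + x]: the left side becomes at most 1, and the right side becomes
    [1 + x ^+ 3]. *)
Lemma expRN_le_quadratic (R : realType) (x : R) : 0 <= x ->
  expR (- x) <= 1 - x + x ^+ 2.
Proof.
move=> x0; have h : expR (- x) * (1 + x) <= 1.
  by rewrite -[leRHS](expRxMexpNx_1 x) mulrC ler_pM2r ?expR_gt0// expR_ge1Dx.
have x1 : 0 < 1 + x by rewrite ltr_wpDr.
rewrite -(ler_pM2r x1); apply: (le_trans h).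
have -> : (1 - x + x ^+ 2) * (1 + x) = 1 + x ^+ 3 by ring.
by rewrite lerDl exprn_ge0.
Qed.

(* The largest [k <= n] such that [d * 2 ^ k <= 2 ^ J]. *)
Fixpoint dyadic_scale (J d n : nat) : nat :=
  if n is n'.+1 then if (d * 2 ^ n <= 2 ^ J)%N then n else dyadic_scale J d n'
  else 0.

Lemma dyadic_scaleP J d n : (d <= 2 ^ J)%N ->
  [/\ (dyadic_scale J d n <= n)%N, (d * 2 ^ dyadic_scale J d n <= 2 ^ J)%N &
      dyadic_scale J d n = n \/ (2 ^ J < d * 2 ^ (dyadic_scale J d n).+1)%N].
Proof.
move=> dJ; elim: n => [|n [IH1 IH2 IH3]] /=; first by rewrite expn0 muln1; split => //; left.
case: ifPn => [h|]; first by split => //; left.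
rewrite -ltnNge => h; split => //; first exact: leqW.
by right; case: IH3 => [->|].
Qed.

Lemma card_near_le (m N l : nat) :
  (\sum_(l' < m) (`|l%:Z - l'%:Z| <= N)%N <= 2 * N + 1)%N.
Proof.
rewrite -(@big_mkord _ _ _ m xpredT (fun l' => nat_of_bool (`|l%:Z - l'%:Z| <= N)%N)).
rewrite (eq_bigr (fun l' => if (`|l%:Z - l'%:Z| <= N)%N then 1%N else 0%N)); last first.
  by move=> l' _; case: ifP.
rewrite -big_mkcond/= sum1_count -size_filter.
have -> : (2 * N + 1 = size (iota (l - N) (2 * N + 1)))%N by rewrite size_iota.
apply: uniq_leq_size; first by rewrite filter_uniq// iota_uniq.
by move=> l'; rewrite mem_filter !mem_iota; lia.
Qed.

Lemma geometric_le (R : realType) (rho : R) n : 0 < rho < 1 ->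
  \sum_(k < n) rho ^+ k <= (1 - rho)^-1.
Proof.
move=> /andP[r0 r1]; have r1' : 0 < 1 - rho by rewrite subr_gt0.
rewrite -[leRHS]mul1r ler_pdivlMr// mulrC -opprB mulNr -subrX1 opprB.
by rewrite gerBl exprn_ge0// ltW.
Qed.

(** * Discretized mass at dyadic scales *)

Definition clamp01 (R : realType) (x : R) : R := Num.max 0 (Num.min 1 x).

(* Clamping the space variable to the unit interval keeps the copies of the
   field that sit in distinct blocks uncorrelated for all indices. *)
Definition dyadic_cov (R : realType) (p q : nat * R) : R :=
  chaos_cov (2 ^- p.1) (2 ^- q.1) (clamp01 p.2) (clamp01 q.2).

(** Here [z (k, x)] stands for the field at scale [2 ^- k] and point [x], whose variance is
    [k%:R * ln 2]. *)
Definition dyadic_density (R : realType) (b : R) (z : nat * R -> R) (k : nat) (x : R) : R :=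
  expR (b * z (k, x) - b ^+ 2 / 2 * (k%:R * ln 2)).

Definition dyadic_mass (R : realType) (b : R) (z : nat * R -> R) (k J : nat) : R :=
  (2 ^- J) * \sum_(l < 2 ^ J) dyadic_density b z k (l%:R / 2 ^+ J).

Lemma clamp01_id (R : realType) (x : R) : 0 <= x <= 1 -> clamp01 x = x.
Proof. by move=> /andP[x0 x1]; rewrite /clamp01 min_r// max_r. Qed.

Lemma clamp01_itv (R : realType) (x : R) : 0 <= clamp01 x <= 1.
Proof. by rewrite /clamp01 le_max lexx/= ge_max ler01 ge_min lexx. Qed.

(** * Truncated second moment estimate for the mass of one block *)

Section nondegeneracy.
Context (R : realType) (b : R).
Local Notation L2 := (ln (2 : R)).
Local Notation dens := (dyadic_density b).

Lemma exp_poly_density K x : exp_poly (@dyadic_cov R) (fun z => dens z K x) 1.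
Proof.
have := exp_poly_expR (@dyadic_cov R) (- (b ^+ 2 / 2 * (K%:R * L2))) [:: (b, (K, x))].
congr exp_poly.
  by apply/funext => z; rewrite /linform big_seq1.
rewrite /covform !big_seq1 /= /dyadic_cov chaos_cov_dyadic_diag//.
by rewrite -[RHS]expR0; congr expR; field.
Qed.

(** The second factor is the Chernoff majorant of the event that the field at scale [2 ^- k] exceeds
    slope [b + mu]. Tilting by the density gives that field the drift [b * (k%:R * L2)], so an
    excess of slope [mu] remains to be paid for. *)
Lemma exp_poly_bad (mu A : R) K k x : (k <= K)%N ->
  exp_poly (@dyadic_cov R)
    (fun z => dens z K x * expR (mu * (z (k, x) - (b + mu) * (k%:R * L2) - A)))
    (expR (- (mu * A)) * expR (- (mu ^+ 2 / 2 * L2)) ^+ k).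
Proof.
move=> kK.
have := exp_poly_expR (@dyadic_cov R)
  (- (b ^+ 2 / 2 * (K%:R * L2)) - mu * ((b + mu) * (k%:R * L2) + A))
  [:: (b, (K, x)); (mu, (k, x))].
congr exp_poly.
  apply/funext => z; rewrite /linform !big_cons big_nil -expRD; congr expR.
  by rewrite /=; ring.
rewrite /covform !big_cons !big_nil /= /dyadic_cov (chaos_covC (2 ^- K) (2 ^- k)).
rewrite !chaos_cov_dyadic_diag// -expRM_natr -expRD; congr expR.
by field.
Qed.

(** Here [k] is the scale at which the two points separate. The pair of densities alone would cost
    [b ^+ 2] per scale; the last factor, a Chernoff majorant of the event that the field at [(k, x)]
    stays below the slope [b *+ 2 - lam], saves [lam ^+ 2 / 2]. *)
Lemma exp_poly_pair (lam A : R) K k x y : (k <= K)%N ->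
  0 <= lam -> 0 < b -> `|clamp01 x - clamp01 y| <= 2 ^- k ->
  (k = K \/ 2 ^- k.+1 < `|clamp01 x - clamp01 y|) ->
  exists2 m, exp_poly (@dyadic_cov R)
    (fun z => dens z K x * dens z K y *
       expR (lam * ((b *+ 2 - lam) * (k%:R * L2) + A - z (k, x)))) m &
    m <= expR (b ^+ 2 * L2 + lam * b + lam * A) *
         expR ((b ^+ 2 - lam ^+ 2 / 2) * L2) ^+ k.
Proof.
move=> kK lam0 b0 xy near.
have := exp_poly_expR (@dyadic_cov R)
  (- (b ^+ 2 * (K%:R * L2)) + lam * ((b *+ 2 - lam) * (k%:R * L2) + A))
  [:: (b, (K, x)); (b, (K, y)); (- lam, (k, x))].
set m := expR _ => Hm; exists m.
  move: Hm; congr exp_poly.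
  apply/funext => z; rewrite /linform !big_cons big_nil -!expRD; congr expR.
  by rewrite /=; field.
rewrite /m /covform !big_cons !big_nil /= /dyadic_cov.
rewrite (chaos_covC (2 ^- K) (2 ^- K) (clamp01 y)) (chaos_covC (2 ^- K) (2 ^- k)).
rewrite (chaos_covC (2 ^- K) (2 ^- k) (clamp01 y)) !chaos_cov_dyadic_diag//.
have := chaos_cov_dyadic_ge kK xy; set c1 := chaos_cov _ _ _ _ => h1.
have := chaos_cov_dyadic_le kK near; set c2 := chaos_cov _ _ _ _ => h2.
rewrite -expRM_natr -expRD ler_expR.
have h3 : b * lam * (k%:R * L2 - 1) <= b * lam * c1.
  by rewrite ler_wpM2l// mulr_ge0// ltW.
have h4 : b * b * c2 <= b * b * (k.+1%:R * L2).
  by rewrite ler_wpM2l// mulr_ge0// ltW.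
rewrite -natr1 in h4; lra.
Qed.

Lemma sum_bad_le (mu : R) : 0 < mu -> exists A : R, forall n : nat,
  \sum_(k < n) expR (- (mu * A)) * expR (- (mu ^+ 2 / 2 * L2)) ^+ k <= 2^-1.
Proof.
move=> mu0; set rho := expR (- _).
have rho01 : 0 < rho < 1.
  rewrite expR_gt0/= expR_lt1 oppr_lt0 mulr_gt0 ?ln2_gt0//.
  by rewrite divr_gt0// exprn_gt0.
have r1 : 0 < 1 - rho by rewrite subr_gt0; case/andP: rho01.
(* With this [A] the prefactor equals [(1 - rho) / 2], half the inverse of the bound on the
   geometric sum. *)
exists (- (ln ((1 - rho) / 2) / mu)) => n.
have -> : - (mu * - (ln ((1 - rho) / 2) / mu)) = ln ((1 - rho) / 2).
  by field; rewrite gt_eqF.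
rewrite lnK ?posrE ?divr_gt0// -big_distrr/=.
apply: (@le_trans _ _ ((1 - rho) / 2 * (1 - rho)^-1)).
  by rewrite ler_pM2l ?divr_gt0// geometric_le.
by rewrite mulrAC divff ?gt_eqF// mul1r.
Qed.

Let point (J : nat) (l : nat) : R := l%:R / 2 ^+ J.

Let scale (J K l l' : nat) : nat := dyadic_scale J `|l%:Z - l'%:Z|%N K.

(** A lower bound for the mass of the good points: a union bound over the scales is subtracted, with
    Chernoff factors in place of indicators. *)
Let lower_term (mu A : R) (z : nat * R -> R) (K J : nat) : R :=
  2 ^- J * \sum_(l < 2 ^ J) (dens z K (point J l) -
    \sum_(k < K.+1) dens z K (point J l) *
      expR (mu * (z (val k, point J l) - (b + mu) * (k%:R * L2) - A))).

(** An upper bound for the squared mass of the good points, each pair being constrained only at its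
    separation scale. *)
Let square_term (mu A : R) (z : nat * R -> R) (K J : nat) : R :=
  2 ^- J * (2 ^- J * \sum_(l < 2 ^ J) \sum_(l' < 2 ^ J)
    dens z K (point J l) * dens z K (point J l') *
      expR ((b - mu) * ((b *+ 2 - (b - mu)) * ((scale J K l l')%:R * L2) + A
        - z (scale J K l l', point J l)))).

Let ord_dist_le (J : nat) (l l' : 'I_(2 ^ J)) : (`|l%:Z - l'%:Z| <= 2 ^ J)%N.
Proof. by have := ltn_ord l; have := ltn_ord l'; lia. Qed.

(* Second moment truncated to the points whose field stays below the slope
   [b + mu] at every scale. *)
Let laplace_mass_le (mu A s : R) z K J : 0 < mu <= b -> 0 <= s ->
  expR (- (s * dyadic_mass b z K J))
    <= 1 - s * lower_term mu A z K J + s ^+ 2 * square_term mu A z K J.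
Proof.
move=> /andP[mu0 mub] s0.
pose good (l : 'I_(2 ^ J)) := [forall k : 'I_K.+1,
  z (val k, point J l) <= (b + mu) * (k%:R * L2) + A].
pose D (l : nat) := dens z K (point J l).
have D0 l : 0 <= D l by exact: expR_ge0.
have J0 : 0 <= (2 ^- J : R) by exact: ltW (exp2V_gt0 _ _).
pose G := 2 ^- J * \sum_(l < 2 ^ J) (good l)%:R * D l.
have G0 : 0 <= G by rewrite mulr_ge0// sumr_ge0// => l _; rewrite mulr_ge0.
have GM : G <= dyadic_mass b z K J.
  rewrite ler_wpM2l// ler_sum// => l _.
  by rewrite -/(D l) ler_piMl// lern1; case: (good l).
have BG : lower_term mu A z K J <= G.
  rewrite ler_wpM2l// ler_sum// => l _; rewrite -/(D l).
  have pos (k : 'I_K.+1) : 0 <= D l *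
      expR (mu * (z (val k, point J l) - (b + mu) * (k%:R * L2) - A)).
    by rewrite mulr_ge0// expR_ge0.
  (* A point that is not good violates the slope at some scale [k], where its Chernoff factor is at
     least 1; that single term already cancels the density. *)
  case: (boolP (good l)) => [_|]; first by rewrite mul1r gerBl sumr_ge0.
  rewrite negb_forall => /existsP[k]; rewrite -ltNge => bad.
  rewrite mul0r subr_le0 (bigD1 k)//= (@le_trans _ _ (D l *
      expR (mu * (z (val k, point J l) - (b + mu) * (k%:R * L2) - A))))//.
    rewrite ler_peMr// (le_trans _ (expR_ge1Dx _))// lerDl mulr_ge0 ?ltW//.
    by rewrite -addrA -opprD subr_gt0.
  by rewrite lerDl sumr_ge0// => k' _; exact: pos.
have GS : G ^+ 2 <= square_term mu A z K J.
  rewrite expr2 /G mulrACA -mulrA ler_wpM2l// ler_wpM2l// big_distrl/=.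
  apply: ler_sum => l _; rewrite big_distrr/=; apply: ler_sum => l' _.
  rewrite -/(D l) -/(D l') mulrACA mulrC ler_wpM2l ?mulr_ge0//.
  (* At a good point the exponent of the last factor is nonnegative, because
     [b *+ 2 - (b - mu) = b + mu]. *)
  case: (boolP (good l)) => [gl|_]; last by rewrite mul0r expR_ge0.
  apply: (@le_trans _ _ 1); first by rewrite mul1r lern1; case: (good l').
  apply: le_trans (expR_ge1Dx _); rewrite lerDl mulr_ge0 ?subr_ge0//.
  have [sK _ _] := dyadic_scaleP K (ord_dist_le l l').
  have := forallP gl (Ordinal (sK : (scale J K l l' < K.+1)%N)).
  by rewrite /=; have -> : b *+ 2 - (b - mu) = b + mu by rewrite mulr2n; ring.
apply: (@le_trans _ _ (expR (- (s * G)))).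
  by rewrite ler_expR lerN2 ler_wpM2l.
apply: (le_trans (expRN_le_quadratic (mulr_ge0 s0 G0))).
rewrite exprMn; apply: lerD; first by rewrite lerD2l lerN2 ler_wpM2l.
by rewrite ler_wpM2l// sqr_ge0.
Qed.

Let exp_poly_lower_term (mu A : R) K J :
  exp_poly (@dyadic_cov R) (fun z => lower_term mu A z K J)
    (1 - \sum_(k < K.+1) expR (- (mu * A)) * expR (- (mu ^+ 2 / 2 * L2)) ^+ k).
Proof.
set c := \sum_(k < _) _.
have -> : 1 - c = 2 ^- J * \sum_(l < 2 ^ J) (1 - c).
  by rewrite sumr_const card_ord -[X in _ * X]mulr_natl natrX mulrA mulVf ?mul1r// expf_neq0.
apply: exp_polyZ; apply: exp_poly_sum => l _.
apply: exp_polyB; first exact: exp_poly_density.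
by apply: exp_poly_sum => k _; apply: exp_poly_bad; exact: ltn_ord k.
Qed.

(** A grid point has at most [3 * 2 ^ (J - k)] grid points within distance [2 ^- k]. Averaging over
    pairs thus gains a factor [2 ^- k] at scale [k], whence the [- 1] in the exponent. *)
Let exp_poly_square_term (mu A : R) K J : (K <= J)%N -> 0 < mu < b ->
  exists2 m, exp_poly (@dyadic_cov R) (fun z => square_term mu A z K J) m &
    m <= 3 * expR (b ^+ 2 * L2 + (b - mu) * b + (b - mu) * A) *
      \sum_(k < K.+1) expR ((b ^+ 2 - (b - mu) ^+ 2 / 2 - 1) * L2) ^+ k.
Proof.
move=> KJ /andP[mu0 mub].
set C := expR (_ + _ + _); set a := b ^+ 2 - _.
have pairs (l l' : 'I_(2 ^ J)) : exists m, exp_poly (@dyadic_cov R) (fun z =>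
    dens z K (point J l) * dens z K (point J l') *
      expR ((b - mu) * ((b *+ 2 - (b - mu)) * ((scale J K l l')%:R * L2) + A
        - z (scale J K l l', point J l)))) m /\
    m <= C * \sum_(k < K.+1) expR (a * L2) ^+ k *
       ((`|l%:Z - l'%:Z| <= 2 ^ (J - k))%N)%:R.
  have [sK sJ near] := dyadic_scaleP K (ord_dist_le l l').
  rewrite -/(scale J K l l') in sK sJ near.
  have dE : `|point J l - point J l'| = (`|l%:Z - l'%:Z|%N)%:R / 2 ^+ J.
    rewrite /point -mulrBl normrM (gtr0_norm (exp2V_gt0 _ J)); congr (_ / _).
    by rewrite natr_absz intr_norm intrB.
  have xy : `|point J l - point J l'| <= 2 ^- scale J K l l'.
    rewrite dE ler_pdivrMr ?exprn_gt0// mulrC ler_pdivlMr ?exprn_gt0//.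
    by rewrite -!natrX -natrM ler_nat.
  have near' : scale J K l l' = K \/ 2 ^- (scale J K l l').+1 < `|point J l - point J l'|.
    case: near => [->|near]; [by left|right].
    rewrite dE ltr_pdivlMr ?exprn_gt0// mulrC ltr_pdivrMr ?exprn_gt0//.
    by rewrite -!natrX -natrM ltr_nat.
  have cl (i : 'I_(2 ^ J)) : clamp01 (point J i) = point J i.
    rewrite clamp01_id// divr_ge0 ?exprn_ge0//= ler_pdivrMr ?exprn_gt0// mul1r.
    by rewrite -natrX ler_nat ltnW.
  rewrite -{}(cl l) -{}(cl l') in xy near'.
  have bm0 : 0 <= b - mu by rewrite subr_ge0 ltW.
  have [m Hm mle] := @exp_poly_pair (b - mu) A K _ _ _ sK bm0 (lt_trans mu0 mub) xy near'.
  exists m; split => //; apply: (le_trans mle); rewrite ler_pM2l ?expR_gt0//.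
  (* The single term at the separation scale is enlarged to a sum over all scales with proximity
     indicators, so that the pairs can be summed first at each scale. *)
  have s1 : (scale J K l l' < K.+1)%N by [].
  rewrite (bigD1 (Ordinal s1))//=.
  have -> : (`|l%:Z - l'%:Z| <= 2 ^ (J - scale J K l l'))%N.
    rewrite -(leq_pmul2r (expn_gt0 2 (scale J K l l'))) -expnD subnK//.
    exact: leq_trans sK KJ.
  by rewrite mulr1 lerDl; apply: sumr_ge0 => k _; rewrite mulr_ge0// exprn_ge0// expR_ge0.
have [m Hm] := choice (fun p : 'I_(2 ^ J) * 'I_(2 ^ J) => pairs p.1 p.2).
exists (2 ^- J * (2 ^- J * \sum_(l < 2 ^ J) \sum_(l' < 2 ^ J) m (l, l'))).
  do 2 apply: exp_polyZ; apply: exp_poly_sum => l _; apply: exp_poly_sum => l' _.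
  by have [] := Hm (l, l').
have J0 : 0 <= (2 ^- J : R) by exact: ltW (exp2V_gt0 _ _).
apply: (@le_trans _ _ (2 ^- J * (2 ^- J * \sum_(l < 2 ^ J) \sum_(l' < 2 ^ J)
    C * \sum_(k < K.+1) expR (a * L2) ^+ k *
       ((`|l%:Z - l'%:Z| <= 2 ^ (J - k))%N)%:R))).
  rewrite !ler_wpM2l//; apply: ler_sum => l _; apply: ler_sum => l' _.
  by have [] := Hm (l, l').
have -> : \sum_(l < 2 ^ J) \sum_(l' < 2 ^ J) C * \sum_(k < K.+1) expR (a * L2) ^+ k *
       ((`|l%:Z - l'%:Z| <= 2 ^ (J - k))%N)%:R
    = C * \sum_(k < K.+1) expR (a * L2) ^+ k * \sum_(l < 2 ^ J)
       (\sum_(l' < 2 ^ J) (`|l%:Z - l'%:Z| <= 2 ^ (J - k))%N)%:R.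
  rewrite big_distrr/=; under eq_bigr do under eq_bigr do rewrite big_distrr/=.
  under eq_bigr do rewrite exchange_big/=.
  rewrite exchange_big/=; apply: eq_bigr => k _; rewrite !big_distrr/=.
  apply: eq_bigr => l _; rewrite natr_sum !big_distrr/=.
  by apply: eq_bigr => l' _; rewrite mulrA.
rewrite (_ : 3 * C = C * 3) ?[3 * C]mulrC// -mulrA.
rewrite [2 ^- J * (C * _)]mulrCA [2 ^- J * (C * _)]mulrCA ler_pM2l ?expR_gt0//.
rewrite !big_distrr/=; apply: ler_sum => k _.
have kJ : (k <= J)%N by apply: leq_trans KJ; exact: ltn_ord k.
rewrite [2 ^- J * (_ ^+ k * _)]mulrCA [2 ^- J * (_ ^+ k * _)]mulrCA.
have -> : expR ((a - 1) * L2) ^+ k = expR (a * L2) ^+ k * 2 ^- k.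
  rewrite mulrBl mul1r expRD exprMn expRN lnK ?posrE//.
  by rewrite exprVn.
rewrite [leRHS]mulrCA ler_pM2l ?exprn_gt0 ?expR_gt0//.
apply: (@le_trans _ _ (2 ^- J * (2 ^- J * \sum_(l < 2 ^ J) (3 * 2 ^ (J - k))%:R))).
  rewrite !ler_wpM2l//; apply: ler_sum => l _; rewrite ler_nat.
  apply: leq_trans (card_near_le _ _ _) _; have : (0 < 2 ^ (J - k))%N by rewrite expn_gt0.
  by lia.
rewrite sumr_const card_ord -[X in _ * (_ * X)]mulr_natl natrX mulKf ?expf_neq0//.
by rewrite natrM natrX expfB_cond ?pnatr_eq0// mulrCA mulKf ?expf_neq0.
Qed.

Lemma dyadic_mass_nondegenerate : 0 < b -> b ^+ 2 < 2 -> exists s q : R,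
  [/\ 0 < s, 0 < q < 1 & forall K J, (K <= J)%N ->
    exists2 h, (forall z, expR (- (s * dyadic_mass b z K J)) <= h z) &
    exists2 m, exp_poly (@dyadic_cov R) h m & m <= q].
Proof.
move=> b0 b2.
(* The first bound keeps [mu] below [b]; the second makes [a = b ^+ 2 / 2 + b * mu - mu ^+ 2 / 2 -
   1] negative, which is where [b ^+ 2 < 2] enters. *)
pose mu := Num.min (b / 2) ((1 - b ^+ 2 / 2) / (2 * b)).
have mu0 : 0 < mu by rewrite lt_min !divr_gt0//=; [lra|rewrite mulr_gt0].
have mub : mu <= b / 2 by rewrite ge_min lexx.
have mu_b : mu < b by lra.
have bmu : b * mu <= (1 - b ^+ 2 / 2) / 2.
  have : mu <= (1 - b ^+ 2 / 2) / (2 * b) by rewrite ge_min lexx orbT.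
  move=> /(ler_wpM2l (ltW b0)) /le_trans; apply.
  by rewrite le_eqVlt; apply/orP; left; apply/eqP; field; rewrite gt_eqF.
pose a := b ^+ 2 - (b - mu) ^+ 2 / 2 - 1.
have a0 : a < 0.
  have : 0 < mu ^+ 2 by rewrite exprn_gt0.
  rewrite /a sqrrB; lra.
have [A HA] := sum_bad_le mu0.
pose rho := expR (a * L2).
have rho01 : 0 < rho < 1.
  by rewrite expR_gt0 expR_lt1 nmulr_rlt0// ln2_gt0.
pose C := 3 * expR (b ^+ 2 * L2 + (b - mu) * b + (b - mu) * A).
have C0 : 0 < C by rewrite mulr_gt0// expR_gt0.
pose S := C / (1 - rho) + 1.
have S1 : 1 <= S.
  by rewrite lerDr divr_ge0 ?ltW// subr_gt0; case/andP: rho01.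
have S0 : 0 < S by exact: lt_le_trans S1.
(* [S] bounds the truncated second moment and the first moment is at least 1/2, so the mean is at
   most [1 - s / 2 + s ^+ 2 * S]; with [s * S = 4^-1] this is [1 - s / 4]. *)
pose s := (4 * S)^-1.
have s0 : 0 < s by rewrite invr_gt0 mulr_gt0.
have sS : s * S = 4^-1 by rewrite /s invfM -mulrA mulVf ?mulr1// gt_eqF.
have s4 : s <= 4^-1 by rewrite -sS ler_peMr// ltW.
exists s, (1 - s / 4); split => //.
  by apply/andP; split; lra.
move=> K J KJ.
have mub2 : 0 < mu < b by rewrite mu0.
exists (fun z => 1 - s * lower_term mu A z K J + s ^+ 2 * square_term mu A z K J).
  by move=> z; apply: laplace_mass_le; rewrite ?mu0 ltW.
have [m Hm mle] := exp_poly_square_term A KJ mub2.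
eexists; first by apply: exp_polyD; [apply: exp_polyB; [exact: exp_poly_cst|
  apply: exp_polyZ; exact: exp_poly_lower_term]|apply: exp_polyZ; exact: Hm].
have mS : m <= S.
  apply: (le_trans mle); rewrite -/C -/a -/rho /S.
  have : C * \sum_(k < K.+1) rho ^+ k <= C / (1 - rho).
    by rewrite ler_pM2l// geometric_le.
  by lra.
have h1 : s * 2^-1 <= s * (1 - \sum_(k < K.+1)
    expR (- (mu * A)) * expR (- (mu ^+ 2 / 2 * L2)) ^+ k).
  by rewrite ler_pM2l//; have := HA K.+1; lra.
have h2 : s ^+ 2 * m <= s * 4^-1.
  by rewrite -sS expr2 -mulrA ler_pM2l// ler_pM2l.
lra.
Qed.

End nondegeneracy.

(** * Exact scaling of the covariance, and Jensen's inequality *)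

Lemma chaos_cov_increment (R : realType) (delta e e' x y u v : R) :
  0 < delta <= 1 -> 0 < e <= 1 -> 0 < e' <= 1 -> `|u - v| = delta * `|x - y| ->
  chaos_cov (e * delta) (e' * delta) u v - chaos_cov delta delta u v
    = chaos_cov e e' x y.
Proof.
move=> /andP[d0 d1] /andP[e0 e1] /andP[e'0 e'1] uv.
have -> : chaos_cov (e * delta) (e' * delta) u v
    = chaos_cov (Num.max e e' * delta) (Num.max e e' * delta) u v.
  by rewrite /chaos_cov maxxx -maxr_pMl// ltW.
have -> : chaos_cov e e' x y = chaos_cov (Num.max e e') (Num.max e e') x y.
  by rewrite /chaos_cov maxxx.
have m0 : 0 < Num.max e e' by rewrite lt_max e0.
have m1 : Num.max e e' <= 1 by rewrite ge_max e1.
move: (Num.max e e') m0 m1 => m m0 m1 {e e' e0 e1 e'0 e'1}.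
rewrite /chaos_cov/= !maxxx uv; set r := `|x - y|; have r0 : 0 <= r by exact: normr_ge0.
have rd : (r * delta < delta) = (r < 1) by rewrite -{2}[delta]mul1r ltr_pM2r.
rewrite (mulrC delta) ltr_pM2r// rd.
(* Below distance [delta] the logarithms and the linear corrections rescale exactly; from there on
   the two covariances on the left coincide and the right side vanishes. *)
case: (ltP r m) => [rm|mr].
  rewrite (lt_le_trans rm m1)/= !div1r !lnV ?posrE ?mulr_gt0//.
  rewrite lnM ?posrE//; field.
  by rewrite !gt_eqF.
have r00 : 0 < r by exact: lt_le_trans mr.
case: (ltP r 1) => [r1|].
  rewrite (ltW r1) ifT; last by rewrite mulr_ile1// ltW.
  rewrite !div1r !lnV ?posrE ?mulr_gt0// lnM ?posrE//; field.
  by rewrite gt_eqF.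
rewrite le_eqVlt => /orP[/eqP <-|r1]; first by rewrite lexx subrr divr1 ln1; ring.
by rewrite subrr (lt_geF r1).
Qed.

(** Beyond distance [delta] the covariance no longer sees the scales, so increments below [delta] on
    separated blocks are uncorrelated. *)
Lemma chaos_cov_far (R : realType) (delta e e' u v : R) :
  e <= delta -> e' <= delta -> delta <= `|u - v| ->
  chaos_cov e e' u v = chaos_cov delta delta u v.
Proof.
move=> ed e'd duv; rewrite /chaos_cov maxxx !ltNge duv /=.
by rewrite ge_max (le_trans ed duv) (le_trans e'd duv).
Qed.

Lemma chaos_cov_maxr (R : realType) (delta e u v : R) : e <= delta ->
  chaos_cov e delta u v = chaos_cov delta delta u v.
Proof. by move=> ed; rewrite /chaos_cov maxxx max_r. Qed.

(* Jensen's inequality for the convex function [x |-> x ^ -r]. *)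
Lemma power_mean_le (R : realType) (I : finType) (w y : I -> R) (r : R) :
  (forall i, 0 < w i) -> 0 <= r -> 0 < \sum_i w i ->
  (\sum_i w i) * expR (- r * ln ((\sum_i w i * expR (y i)) / \sum_i w i))
    <= \sum_i w i * expR (- r * y i).
Proof.
move=> w0 r0 W0; set W := \sum_i w i in W0 *; set A := \sum_i _ * expR (y _).
have A0 : 0 < A.
  have [i|I0] := pickP (xpredT : pred I).
    move=> _; rewrite /A (bigD1 i)//= ltr_pwDl ?mulr_gt0 ?expR_gt0//.
    by apply: sumr_ge0 => j _; rewrite mulr_ge0 ?expR_ge0// ltW.
  move: W0; rewrite /W big1 ?ltxx// => i _.
  by have := I0 i.
have m0 : 0 < A / W by exact: divr_gt0.
set m := A / W in m0 *; have AE : A = m * W by rewrite /m divfK// gt_eqF.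
have key i : w i * (expR (- r * ln m) * (1 - r * (expR (y i) / m - 1)))
    <= w i * expR (- r * y i).
  rewrite ler_pM2l//; have -> : expR (- r * y i)
      = expR (- r * ln m) * expR (- r * (y i - ln m)).
    by rewrite -expRD; congr expR; ring.
  rewrite ler_pM2l ?expR_gt0//; apply: le_trans (expR_ge1Dx _).
  have : r * (1 + (y i - ln m)) <= r * expR (y i - ln m) by rewrite ler_wpM2l// expR_ge1Dx.
  by rewrite expRB lnK ?posrE//; lra.
apply: le_trans (ler_sum _ (fun i _ => key i)).
have -> : \sum_i w i * (expR (- r * ln m) * (1 - r * (expR (y i) / m - 1)))
    = expR (- r * ln m) * ((1 + r) * W - r / m * A).
  rewrite /W /A !big_distrr/= -sumrB big_distrr/=; apply: eq_bigr => i _.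
  by field; rewrite gt_eqF.
rewrite AE le_eqVlt; apply/orP; left; apply/eqP; field; by rewrite gt_eqF.
Qed.

(** * Uncorrelated copies of the field on separated blocks *)

Section blocks.
Context d (T : measurableType d) (R : realType) (P : probability T R).
Variables (X : R -> R -> {RV P >-> R}) (hX : chaos_field X).
Variables (b : R) (b2 : b ^+ 2 < 2).
Variables (N : nat) (N0 : (0 < N)%N).

Let delta : R := (2 * N)%:R^-1.

Let delta_gt0 : 0 < delta.
Proof. by rewrite invr_gt0 ltr0n muln_gt0. Qed.

Let delta_le1 : delta <= 1.
Proof. by rewrite invf_le1 ?ltr0n ?muln_gt0//= ler1n muln_gt0. Qed.

(** Affine chart of block [j], which occupies every second cell of length [delta]; the [N] blocks
    and their gaps fill the unit interval. *)
Definition block_point (j : nat) (x : R) : R := delta * (2 * j%:R + x).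

Let eps (k : nat) : R := 2 ^- k * delta.

Let eps01 k : 0 < eps k <= 1.
Proof.
have e0 := exp2V_gt0 R k; rewrite mulr_gt0//=.
by rewrite mulr_ile1 ?exp2V_le1// ltW.
Qed.

Let eps_le k : eps k <= delta.
Proof. by rewrite ler_piMl ?exp2V_le1// ltW. Qed.

Let XF (p : nat * R) (w : T) : R := X (eps p.1) p.2 w.

Let XF_gaussian : gaussian_family P XF
  (fun p q => chaos_cov (eps p.1) (eps q.1) p.2 q.2).
Proof.
exact: (@chaos_gaussian_family _ _ _ _ _ hX _ (fun p => eps p.1) (fun p => p.2)).
Qed.

(** The increment of the field from scale [delta] to [eps k], as a formal combination; scale index 0
    stands for [delta]. *)
Let incr (p : nat * (nat * R)) : seq (R * (nat * R)) :=
  let u := block_point p.1 (clamp01 p.2.2) in [:: (1, (p.2.1, u)); (-1, (0%N, u))].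

Let eps0 : eps 0 = delta.
Proof. by rewrite /eps expr0 invr1 mul1r. Qed.

Let incr_gaussian : gaussian_family P (fun p w => linform (XF^~ w) (incr p))
  (fun p q => if p.1 == q.1 then dyadic_cov p.2 q.2 else 0).
Proof.
apply: (gaussian_family_bind XF_gaussian) => -[j [k x]] [j' [k' y]] /=.
rewrite /covform /incr !big_cons !big_nil /= !eps0.
set u := block_point j _; set v := block_point j' _.
rewrite (chaos_cov_maxr u v (eps_le k)) (chaos_covC delta (eps k')) (chaos_cov_maxr v u (eps_le k')).
rewrite (chaos_covC delta delta v u).
transitivity (chaos_cov (eps k) (eps k') u v - chaos_cov delta delta u v); first by ring.
have /andP[x0 x1] := clamp01_itv x; have /andP[y0 y1] := clamp01_itv y.
case: (eqVneq j j') => [jj|jj].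
  apply: chaos_cov_increment; rewrite ?exp2V_gt0 ?exp2V_le1 ?delta_gt0//=.
  rewrite /u /v /block_point jj -mulrBr normrM gtr0_norm//; congr (_ * `| _ |).
  by ring.
rewrite (@chaos_cov_far _ delta)// ?subrr//.
rewrite /u /v /block_point -mulrBr normrM gtr0_norm//; apply: ler_peMr; first exact: ltW.
have [h|h|h] := ltngtP j j'; last by rewrite h eqxx in jj.
  have : j%:R + 1 <= j'%:R :> R by rewrite natr1 ler_nat.
  by move=> ?; rewrite ltr0_norm; lra.
have : j'%:R + 1 <= j%:R :> R by rewrite natr1 ler_nat.
by move=> ?; rewrite ger0_norm; lra.
Qed.

Let L := ln ((2 * N)%:R : R).

Let ln_delta : ln (1 / delta) = L.
Proof. by rewrite /delta div1r invrK. Qed.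

Let L0 : 0 <= L.
Proof. by rewrite ln_ge0// ler1n muln_gt0. Qed.

Let cov_eps_diag k k' u : (k <= k')%N ->
  chaos_cov (eps k) (eps k') u u = k%:R * ln 2 + L.
Proof.
move=> kk; have /andP[e0 _] := eps01 k; rewrite chaos_cov_diag// max_l.
  by rewrite lnM ?posrE ?exp2V_gt0// ln_exp2V -ln_delta div1r lnV ?posrE//; ring.
by rewrite ler_pM2r// ler_exp2V.
Qed.

Definition block_density (K J : nat) (w : T) (j : nat) (l : nat) : R :=
  expR (b * X (2 ^- K * delta) (block_point j (l%:R / 2 ^+ J)) w
        - b ^+ 2 / 2 * (K%:R * ln 2 + ln (2 * N)%:R)).

(** The Laplace argument is [expR t], and the three summands of the bound come from the three
    alternatives for the block masses, the total mass and the coarse field. *)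
Lemma blocks_upper_bound (s q : R) (K J : nat) (t r : R) :
  0 < s -> 0 < q -> 0 <= r ->
  (exists2 h, (forall z, expR (- (s * dyadic_mass b z K J)) <= h z) &
     exists2 m, exp_poly (@dyadic_cov R) h m & m <= q) ->
  exists2 m, is_mean P (fun w => expR (- (expR t *
      (delta * (2 ^- J * \sum_(j < N) \sum_(l < 2 ^ J) block_density K J w j l))))) m &
    m <= expR s * q ^+ N + expR (- expR (t / 2))
         + expR (- (r * t / 2) + (r + 1) ^+ 2 * ln (2 * N)%:R).
Proof.
move=> s0 q0 r0 [h mass_h [m Hm mq]]; rewrite -/L.
pose Z j p w := linform (XF^~ w) (incr (j, p)).
pose pt (l : nat) : R := l%:R / 2 ^+ J.
have clpt (l : 'I_(2 ^ J)) : clamp01 (pt l) = pt l.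
  rewrite clamp01_id// divr_ge0 ?exprn_ge0//= ler_pdivrMr ?exprn_gt0// mul1r.
  by rewrite -natrX ler_nat ltnW.
(* The block density factors into the density [wt] of the copy on the block and the coarse density
   [expR y] at scale [delta]. *)
pose wt (w : T) (p : 'I_N * 'I_(2 ^ J)) := dyadic_density b (fun i => Z p.1 i w) K (pt p.2).
pose y (w : T) (p : 'I_N * 'I_(2 ^ J)) : R :=
  b * X delta (block_point p.1 (pt p.2)) w - b ^+ 2 / 2 * L.
have wt0 w p : 0 < wt w p by exact: expR_gt0.
have wy w p : wt w p * expR (y w p) = block_density K J w p.1 p.2.
  rewrite -expRD; congr expR; rewrite /Z /linform /incr !big_cons big_nil /= clpt /XF /= eps0.
  by rewrite /y -/(eps K) -/L -/(pt p.2); ring.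
pose S (f : 'I_N * 'I_(2 ^ J) -> R) := delta * (2 ^- J * \sum_p f p).
have SE w : delta * (2 ^- J * \sum_(j < N) \sum_(l < 2 ^ J) block_density K J w j l)
    = S (fun p => wt w p * expR (y w p)).
  by rewrite /S pair_bigA/=; congr (_ * (_ * _)); apply: eq_bigr => p _; rewrite wy.
have c0 : 0 < delta * 2 ^- J by rewrite mulr_gt0// exp2V_gt0.
have massE w : S (wt w) = delta * \sum_(j < N) dyadic_mass b (fun i => Z j i w) K J.
  rewrite /S; congr (_ * _); rewrite -(pair_bigA _ (fun j l => wt w (j, l)))/=.
  by rewrite big_distrr.
(* Either the normalized mass of the blocks is at most [delta], or the total
   mass is at least [t ^ (-1/2)], or the coarse field is very negative. *)
have pointwise w : expR (- (expR t * S (fun p => wt w p * expR (y w p))))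
    <= expR s * \prod_(j < N) h (fun i => Z j i w) + expR (- expR (t / 2))
       + expR (- (r * t / 2) + (r + 1) * L) * S (fun p => wt w p * expR (- r * y w p)).
  set A := S (fun p => wt w p * expR (y w p)); set B := S (fun p => _ * expR (- r * _)).
  have A0 : 0 <= A.
    by rewrite /A /S mulrA mulr_ge0 ?(ltW c0)// sumr_ge0// => p _; rewrite mulr_ge0 ?expR_ge0.
  have B0 : 0 <= B.
    by rewrite /B /S mulrA mulr_ge0 ?(ltW c0)// sumr_ge0// => p _; rewrite mulr_ge0 ?expR_ge0.
  have t1 : 0 <= expR s * \prod_(j < N) h (fun i => Z j i w).
    rewrite mulr_ge0 ?expR_ge0// prodr_ge0// => j _.
    exact: le_trans (expR_ge0 _) (mass_h _).
  have t2 : 0 <= expR (- expR (t / 2)) by exact: expR_ge0.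
  have t3 : 0 <= expR (- (r * t / 2) + (r + 1) * L) * B by rewrite mulr_ge0 ?expR_ge0.
  have tA : expR (- (expR t * A)) <= 1.
    by rewrite expR_le1 oppr_le0 mulr_ge0 ?expR_ge0.
  have [Wd|Wd] := leP (S (wt w)) delta.
    (* Normalized mass at most [delta] means that the copies have total mass at most 1, so the
       product of their Laplace factors is at least [expR (- s)]. *)
    suff : 1 <= expR s * \prod_(j < N) h (fun i => Z j i w) by lra.
    apply: (@le_trans _ _ (expR s * \prod_(j < N)
        expR (- (s * dyadic_mass b (fun i => Z j i w) K J)))).
      rewrite -expR_sum -expRD -[leLHS]expR0 ler_expR sumrN -big_distrr/=.
      rewrite subr_ge0; apply: ler_piMr; first exact: ltW.
      by move: Wd; rewrite massE -[leRHS]mulr1 ler_pM2l.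
    rewrite ler_pM2l ?expR_gt0//; apply: ler_prod => j _.
    by rewrite expR_ge0 mass_h.
  have [At|At] := leP (expR (- (t / 2))) A.
    suff : expR (- (expR t * A)) <= expR (- expR (t / 2)) by lra.
    rewrite ler_expR lerN2; apply: (@le_trans _ _ (expR t * expR (- (t / 2)))).
      by rewrite -expRD ler_expR; lra.
    by rewrite ler_pM2l ?expR_gt0.
  suff : 1 <= expR (- (r * t / 2) + (r + 1) * L) * B by lra.
  have J0 : (0 < 2 ^ J)%N by rewrite expn_gt0.
  have sum_gt0 (f : 'I_N * 'I_(2 ^ J) -> R) : (forall p, 0 < f p) -> 0 < \sum_p f p.
    move=> f0; rewrite (bigD1 (Ordinal N0, Ordinal J0))//= ltr_pwDl//.
    by apply: sumr_ge0 => p _; exact: ltW.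
  have W0 := sum_gt0 _ (wt0 w).
  have E0 := sum_gt0 _ (fun p => mulr_gt0 (wt0 w p) (expR_gt0 (y w p))).
  have := power_mean_le (y w) (wt0 w) r0 W0.
  set W := \sum_p wt w p in W0 *; set E := \sum_p _ * expR (y w p) in E0 *.
  move=> /(ler_wpM2l (ltW c0)); rewrite mulrA -[X in _ <= X -> _]mulrA -/(S _) -/B => WB.
  have {}Wd : delta < delta * 2 ^- J * W by rewrite -mulrA.
  have {}At : delta * 2 ^- J * E < expR (- (t / 2)) by rewrite -mulrA.
  have dE : delta = expR (- L) by rewrite -ln_delta div1r lnV ?posrE// opprK lnK ?posrE.
  (* Small total mass with fine mass above [delta] forces a small weighted average of the coarse
     density; by Jensen its negative moment [B] is then large. *)
  have lnle : ln (E / W) <= - (t / 2) + L.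
    rewrite -[leRHS]expRK ler_ln ?posrE ?divr_gt0 ?expR_gt0// ler_pdivrMr//.
    rewrite -(ler_pM2l c0) (le_trans (ltW At))// expRD mulrCA -mulrA ler_peMr ?expR_ge0//.
    by rewrite mulrC -ler_pdivrMr ?expR_gt0// mul1r -expRN -dE ltW.
  have : expR (- L) * expR (- r * (- (t / 2) + L)) <= B.
    apply: le_trans WB; apply: ler_pM; rewrite ?expR_ge0 -?dE ?(ltW Wd)//.
    by rewrite ler_expR !mulNr lerN2 ler_wpM2l.
  move=> /(ler_wpM2l (expR_ge0 (- (r * t / 2) + (r + 1) * L))) h1; apply: le_trans h1.
  by rewrite -!expRD -[leLHS]expR0 ler_expR; lra.
have prod_mean : is_mean P (fun w => \prod_(j < N) h (fun i => Z j i w)) (m ^+ N).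
  by have := is_mean_prod_exp_poly N Hm incr_gaussian.
(* Nonnegativity is read off from the product with a single block; it is needed to raise [m <= q] to
   the power [N]. *)
have m0 : 0 <= m.
  have := is_mean_prod_exp_poly 1 Hm incr_gaussian; rewrite expr1.
  apply: (is_mean_le _ (is_mean_cst P 0)) => w; rewrite big_ord1.
  exact: le_trans (expR_ge0 _) (mass_h _).
(* The weight has mean 1 and is uncorrelated with the coarse field, so only the moment of order
   [- r] of the coarse density remains. *)
pose V := expR ((r ^+ 2 + r) * (b ^+ 2 / 2) * L).
have term_mean (p : 'I_N * 'I_(2 ^ J)) : is_mean P (fun w => wt w p * expR (- r * y w p)) V.
  have [_ XK] := XF_gaussian.
  have := XK [:: (b, (K, block_point p.1 (pt p.2))); (- b - r * b, (0%N, block_point p.1 (pt p.2)))].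
  move=> /(is_meanZ (expR (- (b ^+ 2 / 2 * (K%:R * ln 2)) + r * (b ^+ 2 / 2 * L)))).
  rewrite /covform !big_cons !big_nil /= (chaos_covC (eps K) (eps 0)) !cov_eps_diag//.
  set V' := (X in is_mean _ _ X); have -> : V' = V.
    by rewrite /V' -expRD; congr expR; field.
  apply: is_mean_ext => w; rewrite -!expRD; congr expR.
  rewrite /y /Z /linform /incr !big_cons !big_nil /= clpt /XF /= eps0; ring.
(* The factor 1/2 is the proportion of the unit interval covered by the blocks. *)
have S_mean : is_mean P (fun w => S (fun p => wt w p * expR (- r * y w p))) (V / 2).
  have := is_meanZ delta (is_meanZ (2 ^- J) (@is_mean_sum _ _ _ P _ (index_enum _) xpredT _ _
    (fun p _ => term_mean p))).
  set V' := delta * _; suff -> : V' = V / 2 by [].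
  rewrite /V' sumr_const card_prod !card_ord -[X in _ * (_ * X)]mulr_natl natrM natrX.
  rewrite /delta natrM; field; rewrite !pnatr_eq0 -!lt0n N0 /=.
  by rewrite expf_neq0.
have total := is_meanD (is_meanD (is_meanZ (expR s) prod_mean)
  (is_mean_cst P (expR (- expR (t / 2)))))
  (is_meanZ (expR (- (r * t / 2) + (r + 1) * L)) S_mean).
have meas : measurable_fun setT (fun w => expR (- (expR t *
      (delta * (2 ^- J * \sum_(j < N) \sum_(l < 2 ^ J) block_density K J w j l))))).
  apply: measurableT_comp => //; apply: measurableT_comp => //.
  do 3 apply: measurable_funM => //; apply: measurable_sum => j; apply: measurable_sum => l.
  apply: measurableT_comp => //; apply: measurable_funB => //.
  apply: measurable_funM => //; exact: measurable_funPT.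
have [w|M HM /andP[_ Mle]] := is_mean_ge0_dominated meas _ total.
  by rewrite expR_ge0/= SE pointwise.
exists M => //; apply: (le_trans Mle); apply: lerD; first apply: lerD => //.
  by rewrite ler_pM2l ?expR_gt0// lerXn2r ?nnegrE ?(ltW q0).
apply: (@le_trans _ _ (expR (- (r * t / 2) + (r + 1) * L) * V)).
  have V0 : 0 <= V by exact: expR_ge0.
  by rewrite ler_pM2l ?expR_gt0//; lra.
rewrite /V -expRD ler_expR.
(* After [b ^+ 2 / 2 <= 1], the exponents [r ^+ 2 + r] and [r + 1] add up to [(r + 1) ^+ 2]. *)
have : (r ^+ 2 + r) * (b ^+ 2 / 2) * L <= (r ^+ 2 + r) * 1 * L.
  have r20 : 0 <= r ^+ 2 + r by rewrite addr_ge0// exprn_ge0.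
  by rewrite ler_wpM2r// ler_wpM2l// ler_pdivrMr// mul1r ltW.
lra.
Qed.

End blocks.

(** * Lower bound on the Laplace transform by tilting *)

Section lower_bound.
Context d (T : measurableType d) (R : realType) (P : probability T R).
Variables (X : R -> R -> {RV P >-> R}) (hX : chaos_field X).
Variables (b : R) (b0 : 0 < b).

(** Every point of the unit interval is within 1/2 of the centre, and the bound is the value at
    distance exactly 1/2. *)
Lemma chaos_cov_half_ge (e x : R) : 0 < e <= 2^-1 -> 0 <= x <= 1 ->
  ln 2 - 2^-1 <= chaos_cov e 2^-1 x 2^-1.
Proof.
move=> /andP[e0 e1] /andP[x0 x1]; rewrite /chaos_cov max_r//.
have r1 : `|x - 2^-1| <= 2^-1 by rewrite ler_norml; apply/andP; split; lra.
have r0 : 0 <= `|x - 2^-1| by [].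
case: ltP => r.
  by rewrite !div1r invrK; lra.
have -> : `|x - 2^-1| = 2^-1 by apply/eqP; rewrite eq_le r1 r.
by rewrite ifT ?div1r ?invrK; lra.
Qed.

Definition riemann_density (e : R) (n : nat) (w : T) : R :=
  n%:R^-1 * \sum_(l < n) expR (b * X e (l%:R / n%:R) w - b ^+ 2 / 2 * ln (1 / e)).

(* Tilting by the value of the field at scale 1/2 at the centre, which is
   positively correlated with the whole field on the unit interval. *)
Lemma riemann_laplace_ge (e r : R) (n : nat) : 0 < e <= 2^-1 -> 0 <= r -> (0 < n)%N ->
  exists2 m, is_mean P
      (fun w => expR (- (expR (r * b * (ln 2 - 2^-1)) * riemann_density e n w))) m &
    expR (- (r ^+ 2 * ln 2)) / 4 <= m.
Proof.
move=> e01 r0 n0; have /andP[e0 e1] := e01.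
set t := expR (r * b * _); have t0 : 0 < t by exact: expR_gt0.
pose ee (p : option R) : R := if p is Some _ then e else 2^-1.
pose xx (p : option R) : R := if p is Some x then x else 2^-1.
have ee01 p : 0 < ee p <= 1.
  by case: p => [x|] /=; apply/andP; split => //; lra.
have [mF FK] := @chaos_gaussian_family _ _ _ _ _ hX _ ee xx ee01.
pose Z w := X 2^-1 2^-1 w.
have half2 : ln (1 / 2^-1) = ln 2 :> R by rewrite div1r invrK.
have cZ : chaos_cov 2^-1 2^-1 2^-1 2^-1 = ln 2 :> R.
  by rewrite chaos_cov_diag ?invr_gt0// maxxx -half2 div1r [in RHS]lnV ?posrE ?invr_gt0.
have cX x : chaos_cov e e x x = ln (1 / e).
  by rewrite chaos_cov_diag// maxxx div1r lnV.
pose D w := expR (- r * Z w - r ^+ 2 / 2 * ln 2).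
have D_mean : is_mean P D 1.
  have := is_meanZ (expR (- (r ^+ 2 / 2 * ln 2))) (FK [:: (- r, None)]).
  rewrite /covform !big_seq1 /= cZ; set V := (X in is_mean _ _ X).
  have -> : V = 1 by rewrite /V -expRD -[RHS]expR0; congr expR; field.
  by apply: is_mean_ext => w; rewrite -expRD /linform big_seq1; congr expR; rewrite /= addrC.
have D2_mean : is_mean P (fun w => D w ^+ 2) (expR (r ^+ 2 * ln 2)).
  have := is_meanZ (expR (- (r ^+ 2 * ln 2))) (FK [:: (- (2 * r), None)]).
  rewrite /covform !big_seq1 /= cZ; set V := (X in is_mean _ _ X).
  have -> : V = expR (r ^+ 2 * ln 2) by rewrite /V -expRD; congr expR; field.
  apply: is_mean_ext => w; rewrite /D -expRM_natr -expRD /linform big_seq1; congr expR.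
  by rewrite /= /Z; field.
pose f l w := expR (b * X e (l%:R / n%:R) w - b ^+ 2 / 2 * ln (1 / e)).
have DX_mean (l : 'I_n) : is_mean P (fun w => D w * f l w)
    (expR (- (r * b * chaos_cov e 2^-1 (l%:R / n%:R) 2^-1))).
  have := is_meanZ (expR (- (r ^+ 2 / 2 * ln 2) - b ^+ 2 / 2 * ln (1 / e)))
    (FK [:: (- r, None); (b, Some (l%:R / n%:R))]).
  rewrite /covform !big_cons !big_nil /= cZ cX (chaos_covC 2^-1 e).
  set V := (X in is_mean _ _ X); set V' := (X in _ -> is_mean _ _ X).
  have -> : V = V' by rewrite /V -expRD; congr expR; field.
  apply: is_mean_ext => w; rewrite /D /f -!expRD /linform !big_cons big_nil; congr expR.
  by rewrite /= /Z; ring.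
pose G w := riemann_density e n w.
have G0 w : 0 <= G w.
  by rewrite mulr_ge0 ?invr_ge0// sumr_ge0// => l _; exact: expR_ge0.
have mG : measurable_fun setT G.
  apply: measurable_funM => //; apply: measurable_sum => l.
  apply: measurableT_comp => //; apply: measurable_funB => //.
  by apply: measurable_funM => //; exact: measurable_funPT.
have [g DG_mean gle] : exists2 g, is_mean P (fun w => D w * G w) g &
    g <= expR (- (r * b * (ln 2 - 2^-1))).
  exists (n%:R^-1 * \sum_(l < n) expR (- (r * b * chaos_cov e 2^-1 (l%:R / n%:R) 2^-1))).
    have := is_meanZ n%:R^-1 (@is_mean_sum _ _ _ P _ (index_enum _) xpredT _ _
      (fun l _ => DX_mean l)).
    by apply: is_mean_ext => w; rewrite /G /riemann_density/= [RHS]mulrCA [in RHS]big_distrr.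
  rewrite ler_pdivrMl ?ltr0n// mulr_natl.
  apply: (@le_trans _ _ (\sum_(l < n) expR (- (r * b * (ln 2 - 2^-1))))); last first.
    by rewrite sumr_const card_ord.
  apply: ler_sum => l _; rewrite ler_expR lerN2 ler_wpM2l ?mulr_ge0 ?(ltW b0)//.
  apply: chaos_cov_half_ge => //; rewrite divr_ge0//= ler_pdivrMr ?ltr0n// mul1r.
  by rewrite ler_nat ltnW.
(* Half of the Laplace argument is used so that [Q w ^+ 2] is the variable to be estimated. *)
pose Q w := expR (- (t / 2 * G w)).
have mQ : measurable_fun setT Q.
  by apply: measurableT_comp => //; apply: measurableT_comp => //; apply: measurable_funM.
have Q1 w : 0 <= Q w <= 1.
  rewrite expR_ge0/= expR_le1 oppr_le0; apply: mulr_ge0 => //.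
  by rewrite divr_ge0// ltW.
have [|w|v DQ_mean _] := @is_mean_ge0_dominated _ _ _ P (fun w => D w * Q w) D _ _ _ D_mean.
- by apply: measurable_funM => //; exact: is_mean_measurable D_mean.
- have /andP[Q0 Q1'] := Q1 w; rewrite mulr_ge0 ?expR_ge0//= ler_piMr ?expR_ge0//.
(* By [1 - x <= expR (- x)], since the choice of [t] makes [t] times the tilted mean of the mass at
   most 1. *)
have v_ge : 2^-1 <= v.
  apply: (@le_trans _ _ (1 - t / 2 * g)); last first.
    apply: (is_mean_le _ (is_meanB D_mean (is_meanZ (t / 2) DG_mean)) DQ_mean) => w.
    have : D w * (1 - t / 2 * G w) <= D w * Q w.
      by rewrite ler_wpM2l ?expR_ge0//; exact: expR_ge1Dx.
    by lra.
  have tg : t * g <= 1.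
    apply: (@le_trans _ _ (t * expR (- (r * b * (ln 2 - 2^-1))))).
      by rewrite ler_pM2l.
    by rewrite expRxMexpNx_1.
  lra.
have [|w|m Q2_mean _] := @is_mean_ge0_dominated _ _ _ P
    (fun w => expR (- (t * G w))) (fun=> 1) _ _ _ (is_mean_cst P 1).
- by apply: measurableT_comp => //; apply: measurableT_comp => //; apply: measurable_funM.
- by rewrite expR_ge0/= expR_le1 oppr_le0 mulr_ge0// ltW.
exists m => //.
(* Cauchy-Schwarz in the form [D * Q <= D ^+ 2 / (4 * c) + c * Q ^+ 2]: as [c] is the mean of
   [D ^+ 2], the first term contributes 1/4, half of the lower bound on [v]. *)
set c := expR (r ^+ 2 * ln 2); have c0 : 0 < c by exact: expR_gt0.
have cV : expR (- (r ^+ 2 * ln 2)) = c^-1 by rewrite expRN.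
have := is_mean_le _ DQ_mean (is_meanD (is_meanZ ((4 * c)^-1) D2_mean) (is_meanZ c Q2_mean)).
rewrite -/c => H; have {}H : v <= (4 * c)^-1 * c + c * m.
  apply: H => w; have -> : expR (- (t * G w)) = Q w ^+ 2.
    by rewrite /Q -expRM_natr; congr expR; field.
  have := sqr_ge0 (D w / 2 - c * Q w); rewrite sqrrB => h.
  rewrite -(ler_pM2l c0).
  have -> : c * ((4 * c)^-1 * D w ^+ 2 + c * Q w ^+ 2)
      = (D w / 2) ^+ 2 + (c * Q w) ^+ 2 by field; rewrite gt_eqF.
  have -> : c * (D w * Q w) = D w / 2 * (c * Q w) *+ 2 by field.
  lra.
rewrite cV -(ler_pM2l c0).
have e4 : (4 * c)^-1 * c = 4^-1 by rewrite invfM -mulrA mulVf ?mulr1// gt_eqF.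
rewrite e4 in H; rewrite mulrA divff ?gt_eqF//; lra.
Qed.

End lower_bound.

(** * Convergence of Riemann sums *)

Section riemann_sums.
Context (R : realType).
Local Notation mu := (@lebesgue_measure R).

Let cell (n l : nat) : set (measurableTypeR R) :=
  `[l%:R / n.+1%:R, l.+1%:R / n.+1%:R[%classic.

Let step (f : R -> R) (n : nat) (x : measurableTypeR R) : R :=
  \sum_(l < n.+1) f (l%:R / n.+1%:R) * \1_(cell n l) x.

Let cellP (n l : nat) (x : R) : x \in cell n l = (l%:R <= x * n.+1%:R < l.+1%:R).
Proof.
rewrite -[RHS]/((l%:R <= x * n.+1%:R) && (x * n.+1%:R < l.+1%:R)).
rewrite -ler_pdivrMr ?ltr0n// -ltr_pdivlMr ?ltr0n//.
by apply/idP/idP; rewrite inE /cell/= in_itv.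
Qed.

Let stepE (f : R -> R) (n : nat) (x : R) : 0 <= x < 1 ->
  exists2 y, 0 <= y <= 1 & step f n x = f y /\ `|y - x| <= n.+1%:R^-1.
Proof.
move=> /andP[x0 x1]; have nx0 : 0 <= x * n.+1%:R by rewrite mulr_ge0.
have n0 : 0 < n.+1%:R :> R by rewrite ltr0n.
have /andP[l1 l2] := truncn_itv nx0; set l := Num.trunc _ in l1 l2.
have ln : (l < n.+1)%N.
  by rewrite -(ltr_nat R) (le_lt_trans l1)// -[ltRHS]mul1r ltr_pM2r.
exists (l%:R / n.+1%:R).
  by rewrite divr_ge0//= ler_pdivrMr// mul1r ler_nat ltnW.
split; last first.
  rewrite ler0_norm; last by rewrite subr_le0 ler_pdivrMr.
  rewrite opprB lerBlDl -{2}[n.+1%:R^-1]mul1r -mulrDl.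
  by rewrite ler_pdivlMr// natr1 ltW.
rewrite /step (bigD1 (Ordinal ln))//= indicE cellP l1 l2 mulr1 big1 ?addr0// => i il.
rewrite indicE cellP; case: andP => [[i1 i2]|]; last by rewrite mulr0.
case/eqP: il; apply: val_inj => /=.
have := le_lt_trans i1 l2; have := le_lt_trans l1 i2; rewrite !ltr_nat; lia.
Qed.

Lemma riemann_sum_cvg (f : R -> R) : {within `[0, 1], continuous f} ->
  (n.+1%:R^-1 * \sum_(l < n.+1) f (l%:R / n.+1%:R))%:E @[n --> \oo]
    --> (\int[mu]_(x in `[0%R, 1%R]) (f x)%:E)%E.
Proof.
move=> cf.
have intf : mu.-integrable `[0, 1] (EFin \o f).
  by apply: continuous_compact_integrable => //; exact: segment_compact.
pose D : set (measurableTypeR R) := `[0, 1[%classic.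
have mf : measurable_fun D (EFin \o f).
  apply: measurable_funS (measurable_int _ intf) => //.
  by move=> x; rewrite /D/= !in_itv/= => /andP[-> /ltW].
(* The right endpoint is dropped because the half-open cells tile the half-open interval. *)
rewrite -(integral_itv_bndo_bndc mf).
have stepI n : (\int[mu]_(x in D) (step f n x)%:E
    = (n.+1%:R^-1 * \sum_(l < n.+1) f (l%:R / n.+1%:R))%:E)%E.
  under eq_integral do rewrite -sumEFin.
  have mcell l : measurable (cell n l) by exact: measurable_itv.
  have int_ind l : mu.-integrable D (fun x => (\1_(cell n l) x)%:E).
    apply: (integrableS measurableT) => //; first exact: measurable_itv.
    exact: integrable_indic_itv.
  have icell l : mu.-integrable D (fun x => (f (l%:R / n.+1%:R) * \1_(cell n l) x)%:E).
    under eq_fun do rewrite EFinM.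
    apply: integrableZl; first exact: measurable_itv.
    exact: int_ind.
  rewrite integral_sum; [|exact: measurable_itv|exact: icell].
  rewrite mulr_sumr -sumEFin; apply: eq_bigr => l _.
  under eq_integral do rewrite EFinM.
  rewrite integralZl; [|exact: measurable_itv|exact: int_ind].
  rewrite integral_indic; [|exact: measurable_itv|exact: measurable_itv].
  have n0 : 0 < n.+1%:R :> R by rewrite ltr0n.
  have -> : cell n l `&` D = cell n l.
    apply/setIidPl => x; rewrite /cell /D/= !in_itv/= => /andP[x0 x1].
    rewrite (le_trans _ x0) ?divr_ge0//=; apply: (lt_le_trans x1).
    by rewrite ler_pdivrMr// mul1r ler_nat.
  rewrite [X in (_ * X)%E](lebesgue_measure_itv `[l%:R / n.+1%:R, l.+1%:R / n.+1%:R[)/=.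
  rewrite lte_fin ltr_pM2r ?invr_gt0// ltr_nat ltnSn -EFinB -EFinM.
  by rewrite -mulrBl -(natr1 l) [l%:R + 1]addrC addrK mul1r mulrC.
under eq_fun do rewrite -stepI.
have [c1 _ c1P] := EVT_max (@ler01 R) cf.
have cNf : {within `[0, 1], continuous (- f)} by move=> x; apply: cvgN; exact: cf.
have [c2 _ c2P] := EVT_max (@ler01 R) cNf.
pose C := `|f c1| + `|f c2|.
have fC x : 0 <= x <= 1 -> `|f x| <= C.
  move=> x01; have x01' : x \in `[0, 1] by rewrite in_itv.
  have h1 := c1P _ x01'; have := c2P _ x01'; rewrite lerN2 => h2.
  rewrite ler_norml /C; have := ler_norm (f c1); have := ler_norm (- f c2).
  rewrite normrN; have := normr_ge0 (f c1); have := normr_ge0 (f c2).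
  by move=> ? ? ? ?; apply/andP; split; lra.
have [||||||_ _] := @dominated_convergence _ _ _ mu D _ (fun n x => (step f n x)%:E)
  (EFin \o f) (fun=> C%:E); last by [].
- exact: measurable_itv.
- move=> n; apply/measurable_EFinP; apply: measurable_sum => l.
  apply: measurable_funM => //; apply: measurable_indic; exact: measurable_itv.
- exact: mf.
- apply: aeW => x; rewrite /D/= in_itv/= => x01.
  have /choice [y Hy] n : exists y : R,
      [/\ 0 <= y <= 1, step f n x = f y & `|y - x| <= n.+1%:R^-1].
    by have [y y01 [? ?]] := stepE f n x01; exists y.
  rewrite (_ : (fun n => _) = (fun n => (f (y n))%:E)); last first.
    by apply/funext => n; case: (Hy n) => _ -> _.
  apply: cvg_EFin; first exact: nearW.
  have x01' : `[0, 1]%classic x by rewrite /= in_itv/=; case/andP: x01 => -> /ltW.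
  have := (subspace_continuousP _ _).1 cf x x01'; apply: cvg_comp.
  move=> U; rewrite /nbhs/= /within/= => -[e /= e0 eU].
  near=> n; apply: eU; last by rewrite /= in_itv/=; case: (Hy n).
  rewrite /= distrC; case: (Hy n) => _ _ /le_lt_trans; apply.
  by near: n; exact: near_infty_natSinv_lt (PosNum e0).
- apply: (@measurable_bounded_integrable _ _ _ mu (cst C) D) => //.
  + exact: measurable_itv.
  + by rewrite [ltLHS](lebesgue_measure_itv `[0, 1[)/= lte_fin ltr01 -EFinB ltry.
  + exact: bounded_cst.
- apply: aeW => x n; rewrite /D/= in_itv/= => x01.
  by have [y y01 [-> _]] := stepE f n x01; rewrite lee_fin fC.
Unshelve. all: by end_near. Qed.

End riemann_sums.

(** * Limits of means of bounded variables *)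

Section mean_limits.
Context d (T : measurableType d) (R : realType) (P : probability T R).
Implicit Types (f : nat -> T -> R) (g : T -> R).

Definition mean g : R := fine (\int[P]_w (g w)%:E)%E.

Lemma is_mean_mean g m : is_mean P g m -> mean g = m.
Proof. by case=> _; rewrite /mean => ->. Qed.

Lemma bounded_mean_cvg f g : (forall n, measurable_fun setT (f n)) ->
  (forall n w, 0 <= f n w <= 1) -> measurable_fun setT g ->
  {ae P, forall w, f n w @[n --> \oo] --> g w} ->
  mean (f n) @[n --> \oo] --> mean g.
Proof.
move=> mf f01 mg fg.
have [|||||| intg _ cvgI] := @dominated_convergence _ _ _ P setT _
  (fun n w => (f n w)%:E) (EFin \o g) (fun=> 1%:E).
- by [].
- by move=> n; apply/measurable_EFinP; exact: mf.
- exact/measurable_EFinP.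
- apply: filterS fg => w fgw _ /=; apply: cvg_EFin; first exact: nearW.
  exact: fgw.
- exact: finite_measure_integrable_cst.
- apply: aeW => w n _; have /andP[f0 f1] := f01 n w.
  by rewrite /= lee_fin ger0_norm.
apply: fine_cvg; rewrite fineK//; exact: integrable_fin_num.
Qed.

End mean_limits.

(** * From Riemann sums to the chaos measure *)

Section laplace_limits.
Context d (T : measurableType d) (R : realType) (P : probability T R).
Variables (X : R -> R -> {RV P >-> R}) (hX : chaos_field X) (b : R).
Local Notation mu := (@lebesgue_measure R).

Lemma chaos_densityE (e x : R) (w : T) : 0 < e <= 1 ->
  chaos_density X b e w x = expR (b * X e x w - b ^+ 2 / 2 * ln (1 / e)).
Proof.
move=> e01; have /andP[e0 _] := e01; rewrite /chaos_density.
have [_ cXX] := chaos_covE hX x x e01 e01.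
have -> : fine 'E_P[(fun w' => X e x w' ^+ 2)] = ln (1 / e).
  by rewrite unlock cXX /= chaos_cov_diag// maxxx div1r lnV.
by [].
Qed.

Lemma chaos_field_continuous (e : R) (w : T) : 0 < e <= 1 ->
  continuous (fun x => X e x w).
Proof.
move=> e01 x; case: hX => _ _ /(_ w) cX.
have xe : @params R (x, e) by split => //=; rewrite in_itv.
apply: (cvg_comp (fun y => (y, e)) (fun p : R * R => X p.2 p.1 w) _
  ((subspace_continuousP _ _).1 cX _ xe)).
move=> U; rewrite /within/= => -[[A B] /= [xA eB] AB].
apply: filterS xA => y yA; apply: (AB (y, e)).
  by split => //=; exact: nbhs_singleton.
by split => //=; rewrite in_itv.
Qed.

Lemma chaos_density_continuous (e : R) (w : T) : 0 < e <= 1 ->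
  continuous (chaos_density X b e w).
Proof.
move=> e01 x.
rewrite (_ : chaos_density X b e w =
    (fun x => expR (b * X e x w - b ^+ 2 / 2 * ln (1 / e)))); last first.
  by apply/funext => y; exact: chaos_densityE.
apply: continuous_comp; last exact: continuous_expR.
apply: cvgB; last exact: cvg_cst.
by apply: cvgM; [exact: cvg_cst|exact: chaos_field_continuous].
Qed.

Definition density_mass (e : R) (w : T) : R :=
  fine (\int[mu]_(x in `[0%R, 1%R]) (chaos_density X b e w x)%:E)%E.

Lemma integral_densityE (e : R) (w : T) : 0 < e <= 1 ->
  (\int[mu]_(x in `[0%R, 1%R]) (chaos_density X b e w x)%:E
   = (density_mass e w)%:E)%E.
Proof.
move=> e01; rewrite fineK//; apply: integrable_fin_num => //.
apply: continuous_compact_integrable; first exact: segment_compact.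
by apply: continuous_subspaceT; exact: chaos_density_continuous.
Qed.

Lemma riemann_density_cvg (e : R) (w : T) : 0 < e <= 1 ->
  riemann_density X b e n w @[n --> \oo] --> density_mass e w.
Proof.
move=> e01; rewrite -cvg_shiftS.
have cD : {within `[0, 1], continuous (chaos_density X b e w)}.
  by apply: continuous_subspaceT; exact: chaos_density_continuous.
have := riemann_sum_cvg cD; rewrite integral_densityE// => /fine_cvg/=.
by under eq_fun do under eq_bigr do rewrite chaos_densityE//.
Qed.

Lemma measurable_riemann_density (e : R) (n : nat) :
  measurable_fun setT (riemann_density X b e n).
Proof.
apply: measurable_funM => //; apply: measurable_sum => l.
apply: measurableT_comp => //; apply: measurable_funB => //.
by apply: measurable_funM => //; exact: measurable_funPT.
Qed.

Lemma measurable_density_mass (e : R) : 0 < e <= 1 ->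
  measurable_fun setT (density_mass e).
Proof.
move=> e01; apply: (measurable_fun_cvg (measurable_riemann_density e)) => w _.
exact: riemann_density_cvg.
Qed.

Lemma riemann_density_ge0 (e : R) (n : nat) w : 0 <= riemann_density X b e n w.
Proof. by rewrite mulr_ge0 ?invr_ge0// sumr_ge0// => l _; exact: expR_ge0. Qed.

Lemma density_mass_ge0 (e : R) w : 0 <= density_mass e w.
Proof. by apply: fine_ge0; apply: integral_ge0 => x _; rewrite lee_fin expR_ge0. Qed.

Let measurable_laplace (t : R) (f : T -> R) : measurable_fun setT f ->
  measurable_fun setT (fun w => expR (- (t * f w))).
Proof.
move=> mf; apply: measurableT_comp => //; apply: measurableT_comp => //.
exact: measurable_funM.
Qed.

Let laplace01 (t u : R) : 0 <= t -> 0 <= u -> 0 <= expR (- (t * u)) <= 1.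
Proof. by move=> t0 u0; rewrite expR_ge0 expR_le1 oppr_le0 mulr_ge0. Qed.

Lemma laplace_riemann_cvg (e t : R) : 0 < e <= 1 -> 0 <= t ->
  mean P (fun w => expR (- (t * riemann_density X b e n w))) @[n --> \oo]
    --> mean P (fun w => expR (- (t * density_mass e w))).
Proof.
move=> e01 t0; apply: bounded_mean_cvg.
- by move=> n; apply: measurable_laplace; exact: measurable_riemann_density.
- by move=> n w; apply: laplace01 => //; exact: riemann_density_ge0.
- by apply: measurable_laplace; exact: measurable_density_mass.
- apply: aeW => w; apply: continuous_cvg; first exact: continuous_expR.
  by apply: cvgN; apply: cvgMr; exact: riemann_density_cvg.
Qed.

Lemma laplace_cvg (M : R.-ker T ~> (measurableTypeR R)) (t : R) (e : nat -> R) :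
  chaos_measure X b M -> 0 < t -> (forall k, 0 < e k <= 1) ->
  e k @[k --> \oo] --> 0^'+ ->
  mean P (fun w => expR (- (t * density_mass (e k) w))) @[k --> \oo]
    --> laplace P (fun w => M w `[0, 1]%classic) t.
Proof.
move=> hM t0 e01 e0; pose Mw w := M w `[0, 1]%classic.
have mM : measurable_fun setT Mw by apply: measurable_kernel; exact: measurable_itv.
have mMr : measurable_fun setT (fine \o Mw) by exact: measurableT_comp.
pose fin : set T := [set w | (Mw w < +oo)%E].
have mfin : measurable fin.
  rewrite -[fin]setTI; exact: measurable_lte.
(* Where the mass is infinite, [expeR] gives 0, whereas [fine] would turn the mass into 0 and the
   exponential into 1; the indicator restores the value 0. *)
pose g w := expR (- (t * fine (Mw w))) * \1_fin w.
have -> : laplace P Mw t = mean P g.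
  rewrite /laplace /mean; congr fine; apply: eq_integral => w _.
  rewrite /g /fin indicE; have := measure_ge0 (M w) `[0, 1]%classic.
  rewrite -/(Mw w); case E : (Mw w) => [r| |] //= r0.
    by rewrite mem_set ?mulr1//= E ltry.
    by rewrite gt0_muley ?lte_fin//= memNset ?mulr0// /= E ltxx.
  by move: r0; rewrite -/(Mw w) E leeNy_eq.
have hJ : bounded_set [set` `[0, 1] : interval R].
  by apply: compact_bounded; exact: segment_compact.
apply: (@bounded_mean_cvg _ _ _ P (fun k w => expR (- (t * density_mass (e k) w))) g).
- by move=> n; apply: measurable_laplace; exact: measurable_density_mass.
- by move=> n w; apply: laplace01 (ltW t0) _; exact: density_mass_ge0.
- apply: measurable_funM; first exact: measurable_laplace.
  exact: measurable_indic.
apply: filterS (hM `[0, 1] hJ) => w [Mfin cvgM].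
have Mf : Mw w \is a fin_num by rewrite ge0_fin_numE.
rewrite /g indicE mem_set// mulr1.
apply: continuous_cvg; first exact: continuous_expR.
apply: cvgN; apply: cvgMr.
have cst1 : {within [set` `[(0 : R), 1]], continuous (fun=> 1 : R)}.
  by apply: continuous_subspaceT => x; exact: cvg_cst.
have bnd1 : exists C : R, forall x, [set` `[(0 : R), 1]] x -> `|(1 : R)| <= C.
  by exists 1 => x _; rewrite normr1.
(* Testing weak convergence against the constant 1 gives convergence of the total masses. *)
have := cvgM _ cst1 bnd1.
rewrite integral_cst; last exact: measurable_itv.
have MwE : M w `[0, 1]%classic = (fine (Mw w))%:E by rewrite fineK.
rewrite mul1e MwE => /(cvg_comp _ _ e0) /fine_cvg.
apply: cvg_trans; apply: near_eq_cvg; apply: nearW => k.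
by rewrite /density_mass /=; congr fine; apply: eq_integral => x _; rewrite mul1r.
Qed.

End laplace_limits.
(** The terms of the odd-numbered groups of length [m] are nonnegative and are discarded. *)
Lemma sum_even_blocks_le (R : realType) (F : nat -> R) (N m : nat) :
  (forall i, 0 <= F i) ->
  \sum_(j < N) \sum_(l < m) F (2 * j * m + l)%N <= \sum_(i < 2 * N * m) F i.
Proof.
move=> F0; elim: N => [|N IH].
  by rewrite big_ord0 sumr_ge0.
rewrite big_ord_recr/= -!(big_mkord xpredT).
have -> : (2 * N.+1 * m = 2 * N * m + (m + m))%N by lia.
rewrite (@big_cat_nat _ _ _ (2 * N * m)%N) ?leq_addr//= big_mkord lerD//.
have -> : \sum_(2 * N * m <= i < 2 * N * m + (m + m)) F i
    = \sum_(0 <= i < m + m) F (2 * N * m + i)%N.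
  rewrite -{1}[(2 * N * m)%N]add0n big_addn addKn.
  by apply: eq_bigr => i _; rewrite addnC.
rewrite (@big_cat_nat _ _ _ m) ?leq_addr//= big_mkord.
by rewrite lerDl sumr_ge0.
Qed.

Lemma dyadic_cvg0 (R : realType) (delta : R) : 0 < delta ->
  2 ^- k * delta @[k --> \oo] --> 0^'+.
Proof.
move=> d0 U [e /= e0 eU].
have h : (2^-1 : R) ^+ k @[k --> \oo] --> 0.
  by apply: cvg_expr; rewrite ger0_norm ?invr_ge0// invf_lt1// ltr1n.
have ed : 0 < e / delta by rewrite divr_gt0.
move/cvgr0Pnorm_lt : h => /(_ _ ed).
apply: filterS => k hk; apply: eU; last by rewrite mulr_gt0// exp2V_gt0.
rewrite /= sub0r normrN gtr0_norm ?mulr_gt0 ?exp2V_gt0//.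
by rewrite -ltr_pdivlMr// -exprVn (le_lt_trans _ hk)// ler_norm.
Qed.

(** * Bounds on the Laplace transform of the limiting mass *)

Section laplace_bounds.
Context d (T : measurableType d) (R : realType) (P : probability T R).
Variables (X : R -> R -> {RV P >-> R}) (hX : chaos_field X).
Variables (b : R) (b0 : 0 < b) (b2 : b ^+ 2 < 2).
Variables (M : R.-ker T ~> (measurableTypeR R)) (hM : chaos_measure X b M).
Local Notation phi := (laplace P (fun w => M w `[0, 1]%classic)).

Lemma laplace_ge (r : R) : 0 <= r ->
  expR (- (r ^+ 2 * ln 2)) / 4 <= phi (expR (r * b * (ln 2 - 2^-1))).
Proof.
move=> r0; set t := expR (r * _ * _); have t0 : 0 < t by exact: expR_gt0.
(* The scales stay below 1/2, the scale of the tilting variable. *)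
pose e k : R := 2 ^- k * 2^-1.
have e01 k : 0 < e k <= 2^-1.
  by rewrite mulr_gt0 ?exp2V_gt0 ?invr_gt0//= ler_piMl ?invr_ge0// exp2V_le1.
have e1 k : 0 < e k <= 1.
  by have /andP[-> /le_trans ->//] := e01 k; rewrite invf_le1// ler1n.
have e0 : e k @[k --> \oo] --> 0^'+ by apply: dyadic_cvg0; rewrite invr_gt0.
have cvphi := laplace_cvg hX hM t0 e1 e0.
rewrite -(cvg_lim _ cvphi)//; apply: limr_ge; first exact: cvgP cvphi.
apply: nearW => k; have cvk := laplace_riemann_cvg (b := b) hX (e1 k) (ltW t0).
rewrite -(cvg_lim _ cvk)//; apply: limr_ge; first exact: cvgP cvk.
near=> n; have n0 : (0 < n)%N by near: n; exact: nbhs_infty_gt.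
have [m Hm] := riemann_laplace_ge hX b0 (e01 k) r0 n0.
by rewrite (is_mean_mean Hm).
Unshelve. all: by end_near. Qed.

(** With [2 * N * 2 ^ J] points the grid contains the sample points of all blocks, so the Riemann
    sum dominates the block sum. First [J], then [K] tends to infinity; [s] and [q] depend on
    neither these nor [N]. *)
Lemma laplace_le : exists s q : R, 0 < q < 1 /\
  forall (N : nat) (r t : R), (0 < N)%N -> 0 <= r ->
  phi (expR t) <= expR s * q ^+ N + expR (- expR (t / 2))
         + expR (- (r * t / 2) + (r + 1) ^+ 2 * ln (2 * N)%:R).
Proof.
have [s [q [s0 /andP[q0 q1] nondeg]]] := dyadic_mass_nondegenerate b0 b2.
exists s, q; split; first by rewrite q0.
move=> N r t N0 r0; set c := _ + _ + _.
have et0 : 0 < expR t by exact: expR_gt0.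
pose delta : R := (2 * N)%:R^-1.
have N2 : 0 < (2 * N)%:R :> R by rewrite ltr0n muln_gt0.
have d0 : 0 < delta by rewrite invr_gt0.
have d1 : delta <= 1 by rewrite invf_le1// ler1n muln_gt0.
pose e k : R := 2 ^- k * delta.
have e01 k : 0 < e k <= 1.
  have e0 := exp2V_gt0 R k; rewrite mulr_gt0//=.
  by rewrite mulr_ile1 ?exp2V_le1// ltW.
have cvphi := laplace_cvg hX hM et0 e01 (dyadic_cvg0 d0).
rewrite -(cvg_lim _ cvphi)//; apply: limr_le; first exact: cvgP cvphi.
apply: nearW => K; have cvK := laplace_riemann_cvg (b := b) hX (e01 K) (ltW et0).
have nJ : (2 * N * 2 ^ J)%N @[J --> \oo] --> \oo.
  move=> U [n _ nU]; exists n => // J /= nJ; apply: nU => /=.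
  apply: (leq_trans nJ); apply: (leq_trans (ltnW (ltn_expl J (ltnSn 1)))).
  by rewrite leq_pmull// muln_gt0.
have cvKJ := cvg_comp _ _ nJ cvK.
rewrite -(cvg_lim _ cvKJ)//; apply: limr_le; first exact: cvgP cvKJ.
near=> J; have KJ : (K <= J)%N by near: J; exact: nbhs_infty_ge.
have [m Hm] := blocks_upper_bound hX b2 N0 t s0 q0 r0 (nondeg K J KJ).
apply: le_trans.
have mR : measurable_fun setT (fun w => expR (- (expR t *
    riemann_density X b (e K) (2 * N * 2 ^ J) w))).
  apply: measurableT_comp => //; apply: measurableT_comp => //.
  by apply: measurable_funM => //; exact: measurable_riemann_density.
have [|m' Hm' /andP[_ m'm]] := is_mean_ge0_dominated mR _ Hm; last first.
  by rewrite /= (is_mean_mean Hm').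
move=> w; rewrite expR_ge0 ler_expR lerN2 ler_pM2l//=.
rewrite /riemann_density.
pose F (i : nat) := expR (b * X (e K) (i%:R * (delta / 2 ^+ J)) w - b ^+ 2 / 2 * ln (1 / e K)).
have F0 i : 0 <= F i by exact: expR_ge0.
have -> : (2 * N * 2 ^ J)%:R^-1 = delta * 2 ^- J :> R.
  by rewrite natrM natrX invfM.
rewrite mulrA ler_pM2l; last by rewrite mulr_gt0// exp2V_gt0.
apply: le_trans (sum_even_blocks_le N (2 ^ J) F0).
apply: ler_sum => j _; apply: ler_sum => l _.
rewrite /block_density /F -/delta -/(e K) ler_expR le_eqVlt; apply/orP; left; apply/eqP.
congr (b * X _ _ w - _ * _).
  by rewrite /block_point -/delta natrD !natrM natrX; field; rewrite expf_neq0.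
rewrite /e /delta div1r lnV ?posrE ?mulr_gt0 ?exp2V_gt0// lnM ?posrE ?exp2V_gt0//.
by rewrite ln_exp2V lnV ?posrE//; ring.
Unshelve. all: by end_near. Qed.

End laplace_bounds.

(** * Asymptotics of the iterated logarithm *)

Section asymptotics.
Context (R : realType).
Implicit Types (S c C D e : R).

(** Obtained from [1 - 1/2 < expR (- 1/2)]; it makes the correlation bound of [chaos_cov_half_ge]
    positive. *)
Lemma half_lt_ln2 : 2^-1 < ln (2 : R).
Proof.
have h : expR (2^-1 : R) < 2.
  have : 1 + - (2^-1 : R) < expR (- 2^-1) by apply: expR_gt1Dx; rewrite oppr_eq0 invr_eq0.
  rewrite expRN -{1}[1](@divff _ (2 : R))// => h.
  rewrite -ltf_pV2 ?posrE ?expR_gt0// (le_lt_trans _ h)//; lra.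
by rewrite -[ltLHS]expRK ltr_ln ?posrE ?expR_gt0.
Qed.

Lemma sqr_le_expR (x : R) : 0 <= x -> x ^+ 2 / 2 <= expR x.
Proof.
move=> x0; apply: le_trans (expR_ge1Dxn 1 x0).
by rewrite lerDr.
Qed.

(** With [t = expR (expR S)], the square of [ln t] is [expR (2 * S)] and [ln (ln t)] is [S]; the
    loss [1 / S] changes the iterated logarithm only by [o(S)]. *)
Lemma loglog_cvg (phi : R -> R) (c C D S0 : R) : 0 < c -> 0 < C ->
  (forall S, S0 <= S -> 0 < phi (expR (expR S)) /\
     c * (expR (2 * S) / S) - D <= ln (1 / phi (expR (expR S))) <= C * expR (2 * S)) ->
  ln (ln (1 / phi t)) / ln (ln t) @[t --> +oo] --> (2 : R).
Proof.
move=> c0 C0 H; apply/cvgrPdist_le => e e0.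
(* This is the constant left once [e / 2 * S <= expR (e / 2 * S)] has absorbed the division by [S].
   The threshold [S1] makes each constant at most a small multiple of [S]. *)
pose a := ln (c / 2 * (e / 2)).
pose S1 := Num.max (Num.max S0 1) (Num.max (D / c) (Num.max (ln C / e) (- a / (e / 2)))).
near=> t.
have tS : expR (expR S1) < t by near: t; apply: nbhs_pinfty_gt; exact: num_real.
have t0 : 0 < t by apply: lt_trans tS; exact: expR_gt0.
have lt : expR S1 < ln t by rewrite -[ltLHS]expRK ltr_ln ?posrE ?expR_gt0.
have lt0 : 0 < ln t by apply: lt_trans lt; exact: expR_gt0.
have S1S : S1 < ln (ln t) by rewrite -[ltLHS]expRK ltr_ln ?posrE ?expR_gt0.
set S := ln (ln t) in S1S *.
have tE : t = expR (expR S) by rewrite /S !lnK ?posrE.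
have := ltW S1S; rewrite !ge_max => /andP[/andP[S0S S1' ] /andP[DS /andP[CS aS]]].
have {tS lt lt0 S1S t0} Sp : 0 < S by exact: lt_le_trans ltr01 S1'.
rewrite tE; have [phi0 /andP[lo hi]] := H S S0S.
set L := ln (1 / _) in lo hi *.
have e2S : 2 * S <= expR (2 * S) / S.
  rewrite ler_pdivlMr//; have := sqr_le_expR (mulr_ge0 (ler0n R 2) (ltW Sp)).
  by rewrite exprMn; nra.
have DcS : D <= c * S by rewrite mulrC -ler_pdivrMr.
have lo2 : c / 2 * (expR (2 * S) / S) <= L.
  have : c * (2 * S) <= c * (expR (2 * S) / S) by rewrite ler_pM2l.
  by lra.
have lo3 : expR (a + (2 - e / 2) * S) <= L.
  apply: le_trans lo2; rewrite expRD /a lnK; last by rewrite posrE !mulr_gt0 ?divr_gt0.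
  rewrite -mulrA ler_pM2l ?divr_gt0// ler_pdivlMr//.
  have -> : (2 : R) * S = e / 2 * S + (2 - e / 2) * S by ring.
  rewrite expRD mulrAC ler_pM2r ?expR_gt0//.
  by apply: le_trans (expR_ge1Dx _); rewrite lerDr.
have L0 : 0 < L by apply: lt_le_trans lo3; exact: expR_gt0.
have lo4 : a + (2 - e / 2) * S <= ln L.
  by rewrite -[leLHS]expRK ler_ln ?posrE ?expR_gt0.
have hi2 : ln L <= ln C + 2 * S.
  rewrite -[in leRHS](expRK (2 * S)) -lnM ?posrE ?expR_gt0//.
  by rewrite ler_ln ?posrE ?mulr_gt0 ?expR_gt0.
have CS' : ln C <= e * S by rewrite mulrC -ler_pdivrMr.
have aS' : - a <= e / 2 * S by rewrite mulrC -ler_pdivrMr ?divr_gt0.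
rewrite -[2](mulfK (lt0r_neq0 Sp)) -mulrBl normrM (gtr0_norm (x := S^-1)) ?invr_gt0//.
rewrite ler_pdivrMr// ler_norml; apply/andP; split; lra.
Unshelve. all: by end_near. Qed.

(* The choice [N ~ T ^ 2], [r = T / (48 ln T)] in [laplace_le], with [T = exp S]. *)
Lemma log_laplace_ge (phi : R -> R) (s q : R) : 0 < q < 1 ->
  (forall (N : nat) (r t : R), (0 < N)%N -> 0 <= r ->
    phi (expR t) <= expR s * q ^+ N + expR (- expR (t / 2))
         + expR (- (r * t / 2) + (r + 1) ^+ 2 * ln (2 * N)%:R)) ->
  exists2 c, 0 < c & forall S, 96 <= S -> 0 < phi (expR (expR S)) ->
    c * (expR (2 * S) / S) - ln (expR s + 2) <= ln (1 / phi (expR (expR S))).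
Proof.
move=> /andP[q0 q1] H.
have g0 : 0 < - ln q by rewrite oppr_gt0 ln_lt0// q0 q1.
(* The first bound serves the term [q ^+ N], the second the negative moment term. *)
pose c := Num.min (- ln q) (192^-1).
have c0 : 0 < c by rewrite lt_min g0/= invr_gt0.
have cq : c <= - ln q by rewrite ge_min lexx.
have c192 : c <= 192^-1 by rewrite ge_min lexx orbT.
exists c => // S S96 phi0.
have Sp : 0 < S by lra.
pose T := expR S; have T0 : 0 < T by exact: expR_gt0.
have T2E : expR (2 * S) = T ^+ 2 by rewrite /T -expRM_natr mulrC.
have TS : 48 * S <= T.
  apply: le_trans (sqr_le_expR (ltW Sp)); nra.
pose N := (Num.trunc (T ^+ 2)).+1.
have /andP[N1 N2] := truncn_itv (sqr_ge0 T); rewrite -/N in N2.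
have N3 : N%:R <= T ^+ 2 + 1 by rewrite /N -natr1 lerD2r.
pose r := T / (48 * S).
have r1 : 1 <= r by rewrite ler_pdivlMr ?mulr_gt0// mul1r.
have r0 : 0 <= r by lra.
set c' := c * (expR (2 * S) / S); pose U := T ^+ 2 / S.
have U0 : 0 < U by rewrite divr_gt0// exprn_gt0.
have UT : U <= T ^+ 2 by rewrite ler_pdivrMr// ler_peMr ?sqr_ge0//; lra.
have cE : c' = c * U by rewrite /c' T2E.
have b1 : expR s * q ^+ N <= expR s * expR (- c').
  rewrite ler_pM2l ?expR_gt0// -[q in leLHS](lnK (x := q)) ?posrE// -expRM_natr ler_expR.
  have : - ln q * T ^+ 2 <= - ln q * N%:R by rewrite ler_pM2l// ltW.
  have : c * U <= - ln q * T ^+ 2 by apply: ler_pM => //; exact: ltW.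
  by rewrite cE; lra.
have b2 : expR (- expR (T / 2)) <= expR (- c').
  rewrite ler_expR lerN2 cE; apply: (@le_trans _ _ (1 * T ^+ 2)).
    by apply: ler_pM => //; try exact: ltW; lra.
  by rewrite mul1r -T2E ler_expR; lra.
have b3 : expR (- (r * T / 2) + (r + 1) ^+ 2 * ln (2 * N)%:R) <= expR (- c').
  have l2N : ln (2 * N)%:R <= 3 * S.
    have -> : 3 * S = ln (T ^+ 3) by rewrite lnXn// /T expRK mulr_natl.
    rewrite ler_ln ?posrE ?exprn_gt0 ?ltr0n// natrM.
    have : 3 <= T by lra.
    by move=> T3; rewrite exprS; nra.
  have l0 : 0 <= ln (2 * N)%:R :> R by rewrite ln_ge0// ler1n.
  rewrite ler_expR.
  (* As [1 <= r], the square at most quadruples; the 48 in [r] then makes this positive part at most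
     half of [r * T / 2]. *)
  have h1 : (r + 1) ^+ 2 * ln (2 * N)%:R <= 4 * r ^+ 2 * (3 * S).
    apply: ler_pM => //; first exact: sqr_ge0.
    by nra.
  have h2 : 4 * r ^+ 2 * (3 * S) = U / 192 by rewrite /r /U; field; rewrite gt_eqF.
  have h3 : r * T / 2 = U / 96 by rewrite /r /U; field; rewrite gt_eqF.
  have h4 : c * U <= 192^-1 * U by rewrite ler_pM2r.
  rewrite h2 in h1; rewrite h3 cE; lra.
have := H N r T isT r0 => Hphi.
have ub : phi (expR (expR S)) <= (expR s + 2) * expR (- c').
  by apply: (le_trans Hphi); lra.
have es : 0 < expR s + 2 by rewrite addr_gt0 ?expR_gt0.
rewrite div1r lnV ?posrE//.
have : ln (phi (expR (expR S))) <= ln ((expR s + 2) * expR (- c')).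
  by rewrite ler_ln ?posrE ?mulr_gt0 ?expR_gt0.
rewrite lnM ?posrE ?expR_gt0// expRK; lra.
Qed.

End asymptotics.

(** * Both bounds combined at doubly exponential arguments *)

Theorem theorem7 (R : realType) (d : measure_display) (T : measurableType d)
  (P : probability T R) (X : R -> R -> {RV P >-> R}) (beta : R)
  (M : R.-ker T ~> (measurableTypeR R))
  (hbeta : 0 < beta < Num.sqrt 2)
  (hX : chaos_field X)
  (hM : chaos_measure X beta M) :
  let phi := laplace P (fun w => M w `[0, 1]%classic) in
  ln (ln (1 / phi t)) / ln (ln t) @[t --> +oo] --> (2 : R).
Proof.
move=> phi; have /andP[b0 bs] := hbeta.
have b2 : beta ^+ 2 < 2.
  by rewrite -(sqr_sqrtr (ler0n R 2)) ltrXn2r// ?nnegrE ?sqrtr_ge0// ltW.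
have [s [q [q01 upper]]] := laplace_le hX b0 b2 hM.
have [c c0 lower] := log_laplace_ge q01 upper.
have k0 : 0 < ln 2 - 2^-1 :> R by rewrite subr_gt0 half_lt_ln2.
pose a := beta * (ln 2 - 2^-1); have a0 : 0 < a by rewrite mulr_gt0.
have l4 : 0 < ln 4 :> R by rewrite ln_gt0// ltr1n.
(* The term [ln 4] pays for the factor 1/4 of [laplace_ge], since [expR (2 * S)] is at least 1. *)
pose C := ln 2 / a ^+ 2 + ln 4.
have C0 : 0 < C by rewrite addr_gt0// divr_gt0 ?ln2_gt0// exprn_gt0.
apply: (@loglog_cvg _ phi c C (ln (expR s + 2)) 96) => // S S96.
(* This tilting strength makes the Laplace argument [expR (r * a)] of [laplace_ge] equal to
   [expR (expR S)]. *)
have r0 : 0 <= expR S / a by rewrite divr_ge0 ?expR_ge0// ltW.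
have := laplace_ge hX b0 hM r0; rewrite -mulrA -/a divfK ?gt_eqF// -/phi => lo.
have e0 : 0 < expR (- ((expR S / a) ^+ 2 * ln 2)) / 4 by rewrite divr_gt0 ?expR_gt0.
have phi0 : 0 < phi (expR (expR S)) := lt_le_trans e0 lo.
split => //; rewrite lower//=.
have : ln (expR (- ((expR S / a) ^+ 2 * ln 2)) / 4) <= ln (phi (expR (expR S))).
  by rewrite ler_ln ?posrE.
rewrite div1r lnV ?posrE// lnM ?posrE ?expR_gt0 ?invr_gt0// lnV ?posrE// expRK.
have -> : expR (2 * S) = expR S ^+ 2 by rewrite -expRM_natr mulrC.
have -> : (expR S / a) ^+ 2 * ln 2 = ln 2 / a ^+ 2 * expR S ^+ 2.
  by field; rewrite gt_eqF.
have E1 : 1 <= expR S ^+ 2 by rewrite -expRM_natr (le_trans _ (expR_ge1Dx _))// lerDl; lra.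
have : ln 4 <= ln 4 * expR S ^+ 2 :> R by rewrite ler_peMr// ltW.
rewrite /C; lra.
Qed.
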